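(* For every integer $k\ge 3$ there is an $f_1$ such that for all integers $f\ge f_1$ the face hypergraph $\mathcal H(\mathcal F_{k,f})$ of the fan $k$-angulation $\mathcal F_{k,f}$ is, up to isomorphism, the unique $k$-angulation hypergraph on $n=(k-2)f+2$ vertices of maximum spectral radius (the maximum being taken over all $k$-angulation hypergraphs on $n$ vertices).
   Context: For an integer $k\ge3$, a $k$-angulation is a simple $2$-connected outerplane graph all of whose interior faces are bounded by cycles of length $k$. Every vertex lies on the outer face, and the outer face is bounded by a cycle through all vertices. If $G$ has $n$ vertices and $f$ interior faces, then $n-2=f(k-2)$. The face hypergraph $\mathcal H(G)$ is the $k$-uniform hypergraph on $V(G)$ whose edges are the vertex sets of the interior faces of $G$. A $k$-uniform hypergraph is a $k$-angulation hypergraph if it is the face hypergraph of some $k$-angulation. The fan $k$-angulation $\mathcal F_{k,f}$ is the $k$-angulation with $f$ interior faces in which one vertex (the hub) lies on every interior face. The spectral radius of a $k$-uniform hypergraph $\mathcal H$ on $n$ vertices is $$\lambda(\mathcal H)=\max\Bigl\{P_{\mathcal H}(x): x\in\mathbb R_{\ge0}^n,\ \sum_v x_v^k=1\Bigr\},\qquad P_{\mathcal H}(x)=k\sum_{e\in E(\mathcal H)}\prod_{v\in e}x_v .$$ *)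

(* Defs.v *)
From HB Require Import structures.
From mathcomp Require Import all_boot all_order all_fingroup all_algebra.
From mathcomp Require Import classical_sets reals.

Set Implicit Arguments.
Unset Strict Implicit.
Unset Printing Implicit Defensive.

Import Order.TTheory GRing.Theory Num.Theory.

Record sgraph (V : finType) := SGraph {
  adj :> rel V;
  adj_sym : symmetric adj;
  adj_irr : irreflexive adj }.

Section Darts.
Variables (V : finType) (G : sgraph V).

(* A dart is an edge together with an orientation, so an edge is two darts. *)
Definition dart : finType := {d : V * V | adj G d.1 d.2}.

Definition dtail (d : dart) : V := (val d).1.
Definition dhead (d : dart) : V := (val d).2.

Lemma drev_subproof (d : dart) : adj G (dhead d, dtail d).1 (dhead d, dtail d).2.
Proof. by rewrite /= adj_sym; exact: valP d. Qed.

Definition drev (d : dart) : dart :=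
  exist _ (dhead d, dtail d) (drev_subproof d).

Lemma drevK : involutive drev.
Proof. by move=> d; apply: val_inj; rewrite /= -surjective_pairing. Qed.

Definition rev_perm : {perm dart} := perm (inv_inj drevK).

Definition connected_graph : Prop := forall u v : V, connect (adj G) u v.

Definition two_connected : Prop :=
  [/\ 2 < #|V|, connected_graph &
      forall w u v : V, u != w -> v != w ->
        connect [rel x y | [&& adj G x y, x != w & y != w]] u v].

(* The facial walk of a rotation system enters a vertex along d and leaves it *)
(* along the dart that follows the reverse of d in the rotation.              *)
Definition face_perm (rot : {perm dart}) : {perm dart} := (rev_perm * rot)%g.

Definition face_sets (rot : {perm dart}) : {set {set dart}} :=
  porbits (face_perm rot).

End Darts.

(* A connected plane graph, up to homeomorphism of the plane, given as a      *)
(* rotation system with a distinguished (outer) face: pg_rot permutes         *)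
(* cyclically the darts leaving each vertex, the faces are the orbits of the  *)
(* facial walk, and Euler's formula |V| - |E| + |F| = 2 (doubled below, since *)
(* #|dart| = 2 |E|) says that the surface carrying the rotation system is the *)
(* sphere.                                                                    *)
Record plane_graph (V : finType) := PlaneGraph {
  pg_graph :> sgraph V;
  pg_rot : {perm dart pg_graph};
  pg_outer : {set dart pg_graph};
  pg_rotP : forall d d' : dart pg_graph,
    (d' \in porbit pg_rot d) = (dtail d' == dtail d);
  pg_connected : connected_graph pg_graph;
  pg_euler : (#|V| + #|face_sets pg_rot|).*2 = #|{: dart pg_graph}| + 4;
  pg_outerP : pg_outer \in face_sets pg_rot }.

Section KAngulations.
Variables (V : finType) (G : plane_graph V).

Definition interior_faces : {set {set dart G}} :=
  face_sets (pg_rot G) :\ pg_outer G.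

Definition face_verts (F : {set dart G}) : {set V} :=
  [set dtail d | d in F].

(* The facial walk of F, of length #|F|, repeats no vertex. *)
Definition bounded_by_cycle (F : {set dart G}) : Prop :=
  2 < #|F| /\ {in F &, injective (@dtail V G)}.

Definition outerplane : Prop := face_verts (pg_outer G) = [set: V].

(* In a 2-connected plane graph every face, in particular the outer one, is   *)
(* bounded by a cycle.                                                        *)
Definition kangulation (k : nat) : Prop :=
  [/\ two_connected G,
      outerplane,
      bounded_by_cycle (pg_outer G) &
      forall F, F \in interior_faces -> bounded_by_cycle F /\ #|F| = k].

Definition face_hypergraph : {set {set V}} :=
  [set face_verts F | F in interior_faces].

Definition fan_kangulation (k f : nat) : Prop :=
  [/\ kangulation k, #|interior_faces| = f &
      exists hub : V, forall F, F \in interior_faces -> hub \in face_verts F].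

End KAngulations.

(* A hypergraph with vertex set V is given by its set of edges. *)
Definition kangulation_hypergraph (k n : nat) (V : finType)
    (H : {set {set V}}) : Prop :=
  #|V| = n /\ exists2 G : plane_graph V, kangulation G k & H = face_hypergraph G.

Definition hypergraph_iso (V W : finType)
    (H : {set {set V}}) (H' : {set {set W}}) : Prop :=
  exists2 phi : V -> W, bijective phi &
    forall e : {set V}, (phi @: e \in H') = (e \in H).

Section SpectralRadius.
Variables (R : realType) (k : nat) (V : finType) (H : {set {set V}}).
Local Open Scope ring_scope.

Definition hypergraph_form (x : V -> R) : R :=
  k%:R * \sum_(e in H) \prod_(v in e) x v.

(* For V nonempty and 0 < k the supremum is a maximum: the feasible set is    *)
(* compact and nonempty, and the objective is continuous.                     *)
Definition spectral_radius : R :=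
  sup [set hypergraph_form x | x in
        [set x : V -> R | (forall v, 0 <= x v) /\ \sum_v x v ^+ k = 1]]%classic.

End SpectralRadius.

Definition unique_maximizer (R : realType) (k n : nat) (V : finType)
    (H : {set {set V}}) : Prop :=
  kangulation_hypergraph k n H /\
  forall (W : finType) (H' : {set {set W}}), kangulation_hypergraph k n H' ->
    (spectral_radius R k H' <= spectral_radius R k H)%R /\
    (spectral_radius R k H' = spectral_radius R k H -> hypergraph_iso H' H).

(* Main.v *)
(* Let N = 4 f - 6. The fan satisfies lambda ^ k > N: give the hub the weight *)
(* x ^ k = 1 / k and every other vertex, of degree d, x ^ k = d / (k f), and   *)
(* use Bernoulli's inequality together with k (1 - 2 ^ (-1 / k)) < 3 / 4.      *)
(*                                                                            *)
(* A k-angulation with no vertex on all faces satisfies lambda ^ k <= N for    *)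
(* large f. By AM-GM it is enough that every vertex distributes a mass at most *)
(* 1 among its faces so that the product of the masses received by each face   *)
(* is at least 1 / N. A vertex h of degree D shares at most two further        *)
(* vertices of each of its faces with other faces of h, and D - 1 of them in   *)
(* all; if those split their mass in halves, then h itself needs a mass of     *)
(* only (4 D - 3) / N. As D < f there is room for the vertices to save a small *)
(* part of their mass for the other faces. The combinatorics used is that of   *)
(* an order of the faces in which each one is glued to an earlier one along an *)
(* edge; it exists since the dual tree of the k-angulation is connected, and   *)
(* the vertex count forces each new face to bring k - 2 new vertices.          *)

Require Import Defs.
From HB Require Import structures.
From mathcomp Require Import classical_sets reals.
From mathcomp Require Import all_boot all_order all_fingroup all_algebra.
From mathcomp Require Import zify ring lra.

Set Implicit Arguments.
Unset Strict Implicit.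
Unset Printing Implicit Defensive.

Import Order.TTheory GRing.Theory Num.Theory.

(** * Bounds on the spectral radius *)

(** Let [c] be the [k]-th root of [N = 4 f - 6]. For large [f] a face hypergraph with a hub has
    spectral radius above [c] and one without a hub has spectral radius at most [c]. Any two with a
    hub and the same [f] are isomorphic ([fan_hypergraph_iso]), so this gap gives both maximality
    and uniqueness.

    Upper bound. By [spectral_radius_le_labeling] it suffices to distribute mass at most 1 from each
    vertex so that every face receives a product at least [1 / N]. The critical vertices are those
    of degree [D] close to [f]. A face of [h] with [s <= 2] vertices shared with other faces of [h],
    each giving half of its mass, asks [2 ^ s / N <= (1 + 3 s / 2) / N] from [h]. The numbers [s]
    add up to at most [2 (D - 1)], so the demand is at most [(4 D - 3) / N]. Neighbours of [h] that
    also serve faces missing [h] raise it by at most [1 / N] per missed face, to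
    [(f + 3 D - 3) / N], which is at most 1 exactly when [D <= f - 1] ([sum_hub_labels]). The faces
    involving several vertices of large degree are bounded in number and receive constants
    ([card_bad]). The faces with no such vertex are paid for by an orientation of bounded out-degree
    ([card_owned], [card_not_owners]). The result is [hubless_spectral_radius_le].

    Lower bound. A test vector gives [4 f - 8 k (1 - 2 ^ (-1 / k))] as a lower bound for the [k]-th
    power of the radius, which exceeds [N] ([hub_spectral_radius_gt]).

    Both bounds use only the order of the faces from [kangulation_face_order]. Finally
    [fan_plane_graphP] shows by an explicit rotation system that the fan exists. *)

Section RealInequalities.
Variable R : realType.
Implicit Types x c : R.
Local Open Scope ring_scope.

Lemma bernoulli_le x n : -1 <= x -> 1 + n%:R * x <= (1 + x) ^+ n.
Proof.
move=> x_ge; elim: n => [|n IHn]; first by rewrite mul0r addr0 expr0.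
rewrite exprS; apply: le_trans (ler_wpM2l _ IHn); last by lra.
have n_ge0 : 0 <= n%:R :> R by [].
rewrite -natr1; nra.
Qed.

Lemma exists_root (n : nat) c : (0 < n)%N -> 0 <= c -> exists2 y, 0 <= y & y ^+ n = c.
Proof.
move=> n_gt0 c_ge0.
have [||y] := @poly_ivt R ('X^n - c%:P) 0 (1 + c); first by lra.
  rewrite !hornerE expr0n eqn0Ngt n_gt0 /= sub0r oppr_le0 c_ge0 /=.
  rewrite subr_ge0; apply: le_trans (bernoulli_le n _); last by lra.
  have : 1 <= n%:R :> R by rewrite ler1n.
  nra.
move=> /andP[y_ge0 _]; rewrite /root !hornerE subr_eq0 => /eqP yE.
by exists y.
Qed.

Lemma exprn_prod_le (I : finType) (A : {set I}) (E : I -> R) :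
  {in A, forall i, 0 <= E i} ->
  \prod_(i in A) E i <= ((\sum_(i in A) E i) / #|A|%:R) ^+ #|A|.
Proof. by move=> E_ge0; apply: (leif_AGM E_ge0). Qed.

End RealInequalities.

Section SpectralRadiusBounds.
Variables (R : realType) (k : nat) (V : finType) (H : {set {set V}}).
Hypothesis k_gt0 : (0 < k)%N.
Local Open Scope ring_scope.

Lemma hypergraph_form_le_card (x : V -> R) :
  (forall v, 0 <= x v) /\ \sum_v x v ^+ k = 1 ->
  hypergraph_form k H x <= k%:R * #|H|%:R.
Proof.
move=> [x_ge0 x_sum]; rewrite ler_wpM2l // -sum1_card natr_sum ler_sum // => e _.
apply: prodr_ile1 => v _; rewrite x_ge0 /=.
rewrite -(expr_le1 k_gt0) // -x_sum (bigD1 v) //= lerDl sumr_ge0 // => w _.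
exact: exprn_ge0.
Qed.

Lemma spectral_radius_ge (x : V -> R) :
  (forall v, 0 <= x v) -> \sum_v x v ^+ k = 1 ->
  hypergraph_form k H x <= spectral_radius R k H.
Proof.
move=> x_ge0 x_sum; apply: sup_ubound; last by exists x.
by exists (k%:R * #|H|%:R) => _ [y yP <-]; apply: hypergraph_form_le_card.
Qed.

Lemma spectral_radius_le c : 0 <= c ->
  (forall x : V -> R, (forall v, 0 <= x v) -> \sum_v x v ^+ k = 1 ->
     hypergraph_form k H x <= c) ->
  spectral_radius R k H <= c.
Proof.
move=> c_ge0 x_le; rewrite /spectral_radius.
(* The supremum of the empty set is 0, so this case rests on [0 <= c]. *)
set A := (X in sup X); have [->|/classical_sets.set0P A_n0] := eqVneq A classical_sets.set0; first by rewrite sup0.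
by apply: ge_sup => // _ [x [x_ge0 x_sum] <-]; apply: x_le.
Qed.

(* Weighted AM-GM on each edge: the products are compared through the factors *)
(* [B v i * x v ^+ k], whose sum over all incidences is at most 1.            *)
Lemma spectral_radius_le_labeling (I : finType) (E : I -> {set V})
    (B : V -> I -> R) (N c : R) :
  injective E -> H = [set E i | i : I] ->
  (forall i, #|E i| = k) ->
  (forall v i, 0 <= B v i) ->
  (forall v, \sum_(i | v \in E i) B v i <= 1) ->
  (forall i, 1 <= N * \prod_(v in E i) B v i) ->
  0 <= c -> c ^+ k = N ->
  spectral_radius R k H <= c.
Proof.
move=> E_inj HE E_k B_ge0 B_sum B_prod c_ge0 cN.
apply: spectral_radius_le => // x x_ge0 x_sum.
have edge_le i : true ->
    k%:R * \prod_(v in E i) x v <= c * \sum_(v in E i) B v i * x v ^+ k.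
  move=> _; set S := \sum_(v in _) _.
  have S_ge0 : 0 <= S by apply: sumr_ge0 => v _; rewrite mulr_ge0 ?exprn_ge0.
  rewrite -ler_pdivlMl ?ltr0n // mulrCA.
  have prod_ge0 : 0 <= \prod_(v in E i) x v by apply: prodr_ge0.
  rewrite -(@ler_pXn2r _ k) //; first last.
  - by rewrite nnegrE mulr_ge0 // mulr_ge0 // invr_ge0.
  rewrite exprMn cN.
  have := @exprn_prod_le R V (E i) (fun v => B v i * x v ^+ k).
  rewrite -/S E_k big_split /= => /(_ _)/le_trans AGM.
  have {}AGM : (\prod_(v in E i) B v i) * (\prod_(v in E i) x v) ^+ k <= (S / k%:R) ^+ k.
    by rewrite -prodrXl; apply: AGM => // v _; rewrite mulr_ge0 ?exprn_ge0.
  have N_ge0 : 0 <= N by rewrite -cN exprn_ge0.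
  rewrite [k%:R^-1 * _]mulrC; apply: le_trans (ler_wpM2l N_ge0 AGM).
  by rewrite mulrA -[leLHS]mul1r ler_wpM2r ?exprn_ge0.
rewrite /hypergraph_form HE big_imset /=; last by move=> ? ? _ _; apply: E_inj.
rewrite mulr_sumr (le_trans (ler_sum _ edge_le)) //.
rewrite -mulr_sumr ler_piMr // (exchange_big_dep predT) //= -x_sum ler_sum // => v _.
by rewrite -mulr_suml ler_piMl ?exprn_ge0.
Qed.

End SpectralRadiusBounds.

(** * Invariance under isomorphism *)

Section HypergraphIso.

Lemma hypergraph_iso_sym (V W : finType) (H : {set {set V}}) (H' : {set {set W}}) :
  hypergraph_iso H H' -> hypergraph_iso H' H.
Proof.
case=> phi [psi phiK psiK] phiH; exists psi; first by exists phi.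
move=> e; rewrite -phiH -imset_comp (_ : [set _ | x in e] = e) //.
by rewrite (eq_imset (g := id)) ?imset_id // => x /=; rewrite psiK.
Qed.

Lemma hypergraph_iso_trans (V W U : finType) (H : {set {set V}}) (H' : {set {set W}})
    (H'' : {set {set U}}) :
  hypergraph_iso H H' -> hypergraph_iso H' H'' -> hypergraph_iso H H''.
Proof.
case=> phi phi_bij phiH [psi psi_bij psiH]; exists (psi \o phi).
  exact: bij_comp.
by move=> e; rewrite imset_comp psiH phiH.
Qed.

Local Open Scope ring_scope.

Lemma spectral_radius_iso_le (R : realType) (k : nat) (V W : finType)
    (H : {set {set V}}) (H' : {set {set W}}) :
  (0 < k)%N -> hypergraph_iso H H' -> spectral_radius R k H <= spectral_radius R k H'.
Proof.
move=> k_gt0 [phi [psi phiK psiK] phiH].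
have phi_inj := can_inj phiK.
have V_n0 : 0 <= spectral_radius R k H'.
  rewrite /spectral_radius; set A := (X in sup X).
  have [->|/classical_sets.set0P[y Ay]] := eqVneq A classical_sets.set0; first by rewrite sup0.
  have [x [x_ge0 x_sum] xE] := Ay.
  apply: (@le_trans _ _ y); last first.
    by rewrite -xE; apply: spectral_radius_ge.
  by rewrite -xE mulr_ge0 // sumr_ge0 // => e _; apply: prodr_ge0.
apply: spectral_radius_le => // x x_ge0 x_sum.
have -> : hypergraph_form k H x = hypergraph_form k H' (x \o psi).
  congr (_ * _); rewrite (reindex (fun e : {set V} => phi @: e)) /=; last first.
    exists (fun e : {set W} => psi @: e) => e _; rewrite -imset_comp.
      by rewrite (eq_imset (g := id)) ?imset_id // => y /=; rewrite phiK.
    by rewrite (eq_imset (g := id)) ?imset_id // => y /=; rewrite psiK.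
  apply: eq_big => [e|e _]; first by rewrite phiH.
  rewrite big_imset /=; last by move=> ? ? _ _; apply: phi_inj.
  by apply: eq_bigr => v _; rewrite phiK.
apply: spectral_radius_ge => // [v|]; first exact: x_ge0.
rewrite -x_sum (reindex phi) /=; last by exists psi.
by apply: eq_bigr => v _; rewrite phiK.
Qed.

End HypergraphIso.

(** * Orders of the faces *)

Lemma card_bigcup_le (I V : finType) (P : {set I}) (F : I -> {set V}) (m : nat) :
  (forall i, i \in P -> #|F i| <= m) -> #|\bigcup_(i in P) F i| <= #|P| * m.
Proof.
move=> F_le; rewrite -sum_nat_const; elim/big_rec2: _ => [|i n A iP IH].
  by rewrite cards0.
by rewrite (leq_trans (leq_card_setU _ _)) // leq_add // F_le.
Qed.

Section FaceOrder.
Variables (V : finType) (k f : nat).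
Implicit Types (E : 'I_f -> {set V}).

Definition face_deg E (v : V) : nat := #|[set i | v \in E i]|.

Definition face_codeg E (u v : V) : nat := #|[set i | (u \in E i) && (v \in E i)]|.

Definition shared_with E (h : V) (i : 'I_f) : {set V} :=
  [set u in E i | (u != h) && (1 < face_codeg E h u)].

(* The faces are listed so that face [i > 0] is glued to an earlier face along *)
(* the edge [{a i, b i}] and meets the union of the earlier faces in it only.  *)
Record face_order E (a b : 'I_f -> V) : Prop := FaceOrder {
  fo_card : forall i, #|E i| = k;
  fo_neq : forall i, a i != b i;
  fo_attach : forall i, (a i \in E i) && (b i \in E i);
  fo_parent : forall i : 'I_f, 0 < i ->
    exists2 p : 'I_f, p < i & (a i \in E p) && (b i \in E p);
  fo_old : forall (i j : 'I_f) v, j < i -> v \in E i -> v \in E j ->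
    v \in [set a i; b i];
  fo_inj : forall i j : 'I_f, 0 < i -> 0 < j ->
    [set a i; b i] = [set a j; b j] -> i = j }.

(* In a face, only the two neighbours of [h] along the boundary cycle can lie  *)
(* together with [h] in another face.                                         *)
Record polygon_order E (a b : 'I_f -> V) : Prop := PolygonOrder {
  po_face_order :> face_order E a b;
  po_shared : forall i h, h \in E i -> #|shared_with E h i| <= 2 }.

Variables (E : 'I_f -> {set V}) (a b : 'I_f -> V).
Hypothesis fo : face_order E a b.

Lemma set2_eq (x y u v : V) : x != y -> x \in [set u; v] -> y \in [set u; v] ->
  [set u; v] = [set x; y].
Proof.
move=> neq_xy; rewrite !inE => /orP[]/eqP xE /orP[]/eqP yE; subst x y => //.
- by rewrite eqxx in neq_xy.
- exact: setUC.
- by rewrite eqxx in neq_xy.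
Qed.

Lemma old_pair (i j j' : 'I_f) x y : x != y -> j < i -> j' < i ->
  x \in E i -> y \in E i -> x \in E j -> y \in E j' -> [set a i; b i] = [set x; y].
Proof.
move=> neq_xy ji j'i xi yi xj yj'; apply: set2_eq => //.
  exact: (fo_old fo ji).
exact: (fo_old fo j'i).
Qed.

Lemma sum_face_deg : \sum_v face_deg E v = k * f.
Proof.
under eq_bigr do rewrite /face_deg -sum1_card.
rewrite (exchange_big_dep predT) //= (eq_bigr (fun=> k)).
  by rewrite sum_nat_const card_ord mulnC.
by move=> i _; rewrite -(fo_card fo i) -sum1_card; apply: eq_bigl => v; rewrite inE.
Qed.

(** Among the faces containing both vertices, all but the least have [{x, y}] as attaching pair by
    [old_pair], and [fo_inj] lets a pair attach only one face. *)
Lemma face_codeg_le2 x y : x != y -> face_codeg E x y <= 2.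
Proof.
move=> neq_xy; rewrite /face_codeg; set X := [set i | _].
have [->|[i iX]] := set_0Vmem X; first by rewrite cards0.
have [m mX m_min] := arg_minnP (fun i : 'I_f => i : nat) iX.
have {}mX : m \in X by [].
rewrite (cardsD1 m) mX ltnS; apply/card_le1P => j.
rewrite !inE => /andP[jm /andP[xj yj]] j'; rewrite !inE.
have := mX; rewrite inE => /andP[xm ym].
have lt_mj (l : 'I_f) : l != m -> l \in X -> m < l.
  by move=> lm lX; rewrite ltn_neqAle m_min // andbT eq_sym -val_eqE in lm *.
have {}jm : m < j by apply: lt_mj => //; rewrite inE xj.
apply/andP/eqP => [[j'm /andP[xj' yj']]|->]; last first.
  by rewrite xj yj -val_eqE gtn_eqF.
have {}j'm : m < j' by apply: lt_mj => //; rewrite inE xj'.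
apply: (fo_inj fo); try exact: leq_ltn_trans jm; try exact: leq_ltn_trans j'm.
by rewrite (old_pair neq_xy jm jm) // (old_pair neq_xy j'm j'm).
Qed.

(** The value [f], which is no index, stands for a vertex on no face. *)
Definition first_face (v : V) : nat :=
  if [pick i | v \in E i] is Some i then [arg min_(j < i | v \in E j) (j : nat)] else f.

Lemma first_faceP v i : v \in E i ->
  exists2 j : 'I_f, first_face v = j & v \in E j /\ forall l : 'I_f, v \in E l -> j <= l.
Proof.
move=> vi; rewrite /first_face; case: pickP => [i' vi'|/(_ i)]; last by rewrite vi.
by case: arg_minnP => // j vj j_min; exists j.
Qed.

Lemma first_face_le v (i : 'I_f) : v \in E i -> first_face v <= i.
Proof. by move=> vi; have [j -> [_ ->]] := first_faceP vi. Qed.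

(** Take the least face containing both. If it were not the first face of [y], both vertices would
    be old in it, hence its attaching pair, and its parent would be a smaller face containing
    both. *)
Lemma mem_first_face x y (i j : 'I_f) : x \in E i -> y \in E i ->
  first_face x <= first_face y -> first_face y = j -> x \in E j.
Proof.
move=> xi yi xy yj; have [->|neq_xy] := eqVneq x y.
  by have [j' jE [yj' _]] := first_faceP yi; rewrite (_ : j = j') //; apply/val_inj; rewrite /= -yj.
pose P := [pred l | (x \in E l) && (y \in E l)].
have Pi : P i by rewrite /= xi yi.
have [l /andP[xl yl] l_min] := arg_minnP (fun i : 'I_f => i : nat) Pi.
have [jx xE [xjx _]] := first_faceP xi; have [jy yE [yjy _]] := first_faceP yi.
have := first_face_le yl; rewrite leq_eqVlt => /orP[/eqP lE|lt_yl].
  by rewrite (_ : j = l) //; apply/val_inj; rewrite /= -lE yj.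
have jxl : jx < l by rewrite -xE (leq_ltn_trans xy).
have jyl : jy < l by rewrite -yE.
have abE := old_pair neq_xy jxl jyl xl yl xjx yjy.
have [p lt_pl /andP[ap bp]] := fo_parent fo (leq_ltn_trans (leq0n _) jxl).
have sub_p z : z \in [set x; y] -> z \in E p.
  by rewrite -abE !inE => /orP[]/eqP->.
have : l <= p by apply: l_min; rewrite /P /= !sub_p // !inE eqxx ?orbT.
by rewrite leqNgt lt_pl.
Qed.

(* The orientation that 2-degeneracy provides: a face is owned by all its      *)
(* vertices but at most one, and a vertex owns boundedly many faces.          *)
Definition owns (v : V) (i : 'I_f) : bool :=
  (v \in E i) && ((first_face v == i) ||
    (v \in [set a i; b i]) && [forall w in [set a i; b i], first_face w <= first_face v]).

(** Besides its first face [j], the vertex [v] owns only faces attached along some [{v, w}] with [w]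
    appearing no later than [v]. Such a [w] lies in [E j] by [mem_first_face] and determines the
    face by [fo_inj], which leaves [k - 1] choices. *)
Lemma card_owned v : #|[set i | owns v i]| <= k.
Proof.
have [->|[i]] := set_0Vmem [set i | owns v i]; first by rewrite cards0.
rewrite inE => /andP[vi _]; have [j vE [vj j_min]] := first_faceP vi.
rewrite (cardsD1 j) -(fo_card fo j) [X in _ <= X](cardsD1 v) vj.
apply: leq_add; first by case: (_ \in _).
pose other (i : 'I_f) := if a i == v then b i else a i.
have ownP l : l \in [set i | owns v i] :\ j ->
    [/\ 0 < l, [set a l; b l] = [set v; other l], other l != v & other l \in E j].
  rewrite !inE => /andP[lj /andP[vl]]; rewrite vE eq_sym val_eqE (negPf lj) /=.
  move=> /andP[v_ab /forall_inP v_max].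
  have lt_jl : j < l by rewrite ltn_neqAle j_min // andbT eq_sym.
  have neq_ab := fo_neq fo l; have /andP[al bl] := fo_attach fo l.
  rewrite /other; have [av|neq_av] := eqVneq (a l) v.
    split=> //; [exact: leq_ltn_trans lt_jl|by rewrite av|by rewrite -av eq_sym|].
    by apply: (mem_first_face bl vl _ vE); rewrite vE v_max // !inE eqxx orbT.
  have bv : b l = v by move: v_ab; rewrite !inE eq_sym (negPf neq_av) => /eqP.
  split=> //; [exact: leq_ltn_trans lt_jl|by rewrite bv setUC|].
  by apply: (mem_first_face al vl _ vE); rewrite vE v_max // !inE eqxx.
rewrite -(card_in_imset (f := other)); last first.
  move=> l l' /ownP[l0 lE _ _] /ownP[l'0 l'E _ _] eq_o.
  by apply: (fo_inj fo) => //; rewrite lE l'E eq_o.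
apply/subset_leq_card/subsetP => _ /imsetP[l /ownP[_ _ neq_o o_j] ->].
by rewrite !inE neq_o.
Qed.

(** A vertex that does not own its face is old there. Two of them would form the attaching pair, but
    the one that appears later owns the face. *)
Lemma card_not_owners i : #|[set v in E i | ~~ owns v i]| <= 1.
Proof.
apply/card_le1P => x; rewrite !inE => /andP[xi nx] y; rewrite !inE.
apply/andP/eqP => [[yi ny]|->]; last by rewrite xi.
apply/eqP; apply: contraT => neq_yx.
have lt_i z : z \in E i -> ~~ owns z i -> exists2 j : 'I_f, j < i & z \in E j.
  move=> zi; rewrite /owns zi /= negb_or => /andP[neq_zi _].
  have [j zE [zj _]] := first_faceP zi; exists j => //.
  by rewrite -zE ltn_neqAle neq_zi first_face_le.
have [j ji xj] := lt_i _ xi nx; have [j' j'i yj'] := lt_i _ yi ny.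
have neq_xy : x != y by rewrite eq_sym.
have abE := old_pair neq_xy ji j'i xi yi xj yj'.
move: nx ny; rewrite /owns xi yi abE !inE !eqxx orbT /= !negb_or.
have [xy|/ltnW yx] := leqP (first_face x) (first_face y).
  move=> _ /andP[_ /negP[]]; apply/forall_inP => z.
  by rewrite !inE => /orP[]/eqP->.
move=> /andP[_ /negP[]]; apply/forall_inP => z.
by rewrite !inE => /orP[]/eqP->.
Qed.

(** By [mem_first_face], a common neighbour no later than [h1] or [h2] lies in the first face of
    that vertex. A later one has both in its own first face, which is one of the at most two faces
    containing [h1] and [h2]. This gives [k + k + 2 * k]. *)
Lemma card_common_neighbors h1 h2 : h1 != h2 ->
  #|[set v | (0 < face_codeg E v h1) && (0 < face_codeg E v h2)]| <= 4 * k.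
Proof.
move=> neq_h; set X := [set v | _].
have [->|[v0]] := set_0Vmem X; first by rewrite cards0.
rewrite inE => /andP[]; rewrite /face_codeg => /card_gt0P[i1].
rewrite inE => /andP[_ h1i] /card_gt0P[i2]; rewrite inE => /andP[_ h2i].
have [j1 h1E [h1j _]] := first_faceP h1i; have [j2 h2E [h2j _]] := first_faceP h2i.
pose U := \bigcup_(i in [set i | (h1 \in E i) && (h2 \in E i)]) E i.
have leU : #|U| <= 2 * k.
  apply: (@leq_trans (face_codeg E h1 h2 * k)); last first.
    by rewrite leq_mul2r face_codeg_le2 ?orbT.
  by apply: card_bigcup_le => i _; rewrite (fo_card fo).
have -> : 4 * k = k + k + 2 * k by lia.
apply: leq_trans (_ : #|E j1 :|: E j2 :|: U| <= _); last first.
  apply: leq_trans (leq_card_setU _ _) _; rewrite leq_add // -?{1}(fo_card fo j1).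
  by apply: leq_trans (leq_card_setU _ _) _; rewrite !(fo_card fo).
apply/subset_leq_card/subsetP => v; rewrite inE /face_codeg => /andP[].
move=> /card_gt0P[l1]; rewrite inE => /andP[vl1 h1l1].
move=> /card_gt0P[l2]; rewrite inE => /andP[vl2 h2l2].
rewrite !in_setU.
have [vh1|/ltnW h1v] := leqP (first_face v) (first_face h1).
  by rewrite (mem_first_face vl1 h1l1 vh1 h1E).
have [vh2|/ltnW h2v] := leqP (first_face v) (first_face h2).
  by rewrite (mem_first_face vl2 h2l2 vh2 h2E) orbT.
have [j vE [vj _]] := first_faceP vl1.
apply/orP; right; apply/bigcupP; exists j => //.
by rewrite inE (mem_first_face h1l1 vl1 h1v vE) (mem_first_face h2l2 vl2 h2v vE).
Qed.

(* A pair [{h, u}] shared by two faces is the attaching pair of the later one, *)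
(* and the first face of [h] attaches to none.                                 *)
Lemma card_shared_total h :
  #|[set u | (u != h) && (1 < face_codeg E h u)]| <= (face_deg E h).-1.
Proof.
set U := [set u | _].
have laterP u : u \in U -> exists i : 'I_f, exists2 j : 'I_f,
    j < i & [/\ h \in E i, h \in E j & [set a i; b i] = [set h; u]].
  rewrite inE => /andP[neq_uh]; rewrite eq_sym in neq_uh.
  case/card_gt1P => i [j []]; rewrite !inE.
  move=> /andP[hi ui] /andP[hj uj] neq_ij.
  have [ij|ji|/val_inj eq_ij] := ltngtP i j; last by rewrite eq_ij eqxx in neq_ij.
    by exists j, i => //; split=> //; exact: (old_pair neq_uh ij ij hj uj hi ui).
  by exists i, j => //; split=> //; exact: (old_pair neq_uh ji ji hi ui hj uj).
have [->|[u0 /laterP[i0 [j0 _ [hi0 _ _]]]]] := set_0Vmem U; first by rewrite cards0.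
have [t hE [ht t_min]] := first_faceP hi0.
pose later u := odflt i0 [pick i : 'I_f | [&& i != t, h \in E i, 0 < i & [set a i; b i] == [set h; u]]].
have later_spec u : u \in U ->
    [/\ later u != t, h \in E (later u), 0 < later u
      & [set a (later u); b (later u)] = [set h; u]].
  move=> uU; rewrite /later; case: pickP => [i /and4P[? ? ? /eqP ?] //|].
  have [i [j ji [hi hj abE]]] := laterP u uU; move/(_ i).
  rewrite hi abE eqxx (leq_ltn_trans (leq0n _) ji) /= andbT => /negbFE/eqP iE.
  by have := t_min _ hj; rewrite leqNgt -iE ji.
have -> : (face_deg E h).-1 = #|[set i | h \in E i] :\ t|.
  by rewrite /face_deg (cardsD1 t) inE ht.
rewrite -(card_in_imset (f := later)); last first.
  move=> u u' uU u'U eq_l; have [_ _ _ uE] := later_spec u uU.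
  have [_ _ _ u'E] := later_spec u' u'U.
  have : u \in [set h; u'] by rewrite -u'E -eq_l uE !inE eqxx orbT.
  by move: uU; rewrite !inE => /andP[/negPf-> _] /eqP.
apply/subset_leq_card/subsetP => _ /imsetP[u uU ->].
by have [lt hl _ _] := later_spec u uU; rewrite !inE lt.
Qed.

(** Each shared vertex is counted once for each of the at most two faces it has in common with
    [h]. *)
Lemma sum_shared h :
  \sum_(i | h \in E i) #|shared_with E h i| <= 2 * (face_deg E h).-1.
Proof.
apply: leq_trans (_ : 2 * #|[set u | (u != h) && (1 < face_codeg E h u)]| <= _); last first.
  by rewrite leq_mul2l card_shared_total orbT.
under eq_bigr do rewrite -sum1_card.
rewrite (exchange_big_dep (fun u => u \in [set u | (u != h) && (1 < face_codeg E h u)])) /=;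
  last by move=> i u _; rewrite !inE => /andP[_ ->].
rewrite mulnC -sum_nat_const leq_sum // => u; rewrite inE => /andP[neq_uh cd_u].
apply: leq_trans (_ : face_codeg E h u <= _); last by rewrite face_codeg_le2 // eq_sym.
rewrite /face_codeg -sum1_card; apply/eq_leq/eq_bigl => i.
by rewrite !inE neq_uh cd_u !andbT.
Qed.

End FaceOrder.

(** * Distributing the masses of the vertices *)

Section Labeling.
Variables (R : realType) (V : finType) (k f : nat).
Variables (E : 'I_f -> {set V}) (a b : 'I_f -> V).
Hypothesis fo : polygon_order k E a b.
Hypothesis no_hub : forall v, face_deg E v < f.

Let deg := face_deg E.
Let codeg := face_codeg E.

Local Open Scope ring_scope.

(** A straying vertex gives up the fraction [1 / (1 + kappa)] to the faces of its high vertex and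
    keeps [theta] for the others. There an owner pays [tau]. The constant [eps] is the threshold for
    high degree, and [zeta] is paid on exceptional faces. *)
Variables (kappa theta tau eps zeta : R).
Let N : R := 4 * f%:R - 6.
(** With at most [k / eps] high vertices, the first term counts two faces for each pair of them. The
    second counts, for each pair, at most [4 * k] common neighbours, each on at most two faces with
    each high vertex. *)
Let K : R := 2 * (k%:R / eps) ^+ 2 + 8 * k%:R * (k%:R / eps) ^+ 3.

Hypothesis k_ge3 : (3 <= k)%N.
Hypothesis f_ge2 : (2 <= f)%N.
Hypothesis kappa_gt0 : 0 < kappa.
Hypothesis kappa_exp : (1 + kappa) ^+ k <= 1 + (8 * k%:R)^-1.
Hypothesis theta_le : theta <= 1 / 2.
Hypothesis kappa_theta : (1 + kappa)^-1 + theta <= 1.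
Hypothesis kappa_half : 1 / 2 <= (1 + kappa)^-1.
Hypothesis tau_gt0 : 0 < tau.
Hypothesis tau_le : k%:R * tau <= theta / 2.
Hypothesis tau_large : 1 <= N * tau ^+ k.
Hypothesis eps_gt0 : 0 < eps.
Hypothesis eps_le1 : eps <= 1.
Hypothesis eps_le : eps <= theta / 2 * tau ^+ k.-1.
Hypothesis eps_large : 9 <= 2 * eps * f%:R.
Hypothesis zeta_gt0 : 0 < zeta.
Hypothesis zeta_le : zeta <= 1 / 4.
Hypothesis zeta_large : 1 <= N * zeta ^+ k.
Hypothesis zeta_K : zeta * K <= eps / 4.

Let N_ge_f : f%:R <= N.
Proof. by have : 2 <= f%:R :> R; [rewrite ler_nat | rewrite /N; lra]. Qed.

Let f_gt0 : 0 < f%:R :> R.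
Proof. by rewrite ltr0n; apply: leq_trans f_ge2. Qed.

Let N_gt0 : 0 < N.
Proof. exact: lt_le_trans N_ge_f. Qed.

(* [high_verts] are the vertices of degree at least [eps * f]; their number is *)
(* bounded, hence so is the number of the faces that involve two of them in    *)
(* some way ([exceptional]), where every vertex can afford the same constant   *)
(* [zeta]. On the other faces with a high vertex [h], a vertex [v] splits its  *)
(* mass evenly among the one or two faces it shares with [h], keeping a little *)
(* back if it [strays] to other faces, and [h] supplies the missing factor. On *)
(* a face without high vertices the owners give [tau], and the only possible   *)
(* other vertex, being of low degree, can afford the tiny missing factor.      *)
Definition high_verts : {set V} := [set v | eps * f%:R <= (deg v)%:R].

Definition crowded (v : V) : bool :=
  (v \notin high_verts) && [exists h1 in high_verts, exists h2 in high_verts,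
    [&& h1 != h2, (0 < codeg v h1)%N & (0 < codeg v h2)%N]].

Definition exceptional (i : 'I_f) : bool :=
  (1 < #|E i :&: high_verts|)%N
  || (E i :&: high_verts != finset.set0) && [exists v in E i, crowded v].

Definition strays (h v : V) : bool := [exists i, (v \in E i) && (h \notin E i)].

Definition mass (h v : V) : R := if strays h v then (1 + kappa)^-1 else 1.

Definition hub_label (h : V) (i : 'I_f) : R :=
  N^-1 * \prod_(v in E i :\ h) ((codeg h v)%:R / mass h v).

Definition label (v : V) (i : 'I_f) : R :=
  if exceptional i then zeta
  else if [pick h in E i :&: high_verts] is Some h then
    if v == h then hub_label h i else mass h v / (codeg h v)%:R
  else if owns E a b v i then tau else N^-1 / tau ^+ k.-1.

Let codeg_gt0 i u v : u \in E i -> v \in E i -> (0 < codeg u v)%N.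
Proof. by move=> ui vi; apply/card_gt0P; exists i; rewrite inE ui. Qed.

Let mass_ge h v : 1 / 2 <= mass h v.
Proof. by rewrite /mass; case: ifP => // _; lra. Qed.

Let mass_gt0 h v : 0 < mass h v.
Proof. by apply: lt_le_trans (mass_ge h v); lra. Qed.

Lemma label_ge0 v i : 0 <= label v i.
Proof.
have mass_ge0 h w : 0 <= mass h w by apply: ltW.
rewrite /label; case: ifP => _; first exact: ltW.
case: pickP => [h _|_]; case: ifP => _; try exact: ltW.
- apply: mulr_ge0; first by rewrite invr_ge0 ltW.
  by apply: prodr_ge0 => w _; rewrite mulr_ge0 ?invr_ge0.
- by rewrite mulr_ge0 ?invr_ge0.
- by rewrite mulr_ge0 ?invr_ge0 ?exprn_ge0 ?(ltW N_gt0) ?(ltW tau_gt0).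
Qed.

(** Exceptional faces use [zeta_large]. On a face with a single high vertex, [hub_label] is the
    factor that makes the product exactly [1 / N]. On a face without high vertices, [tau_large]
    suffices if all its vertices own it. Otherwise the only other vertex supplies what the [k - 1]
    factors [tau] lack. *)
Lemma label_prod i : 1 <= N * \prod_(v in E i) label v i.
Proof.
have [bad_i|good_i] := boolP (exceptional i).
  rewrite (eq_bigr (fun=> zeta)); last by move=> v _; rewrite /label bad_i.
  by rewrite prodr_const (fo_card fo).
case: (pickP [pred h in E i :&: high_verts]) => [h hi|no_h].
  have hE : h \in E i by move: hi; rewrite !inE => /andP[].
  have labelE v : v \in E i -> label v i =
      if v == h then hub_label h i else mass h v / (codeg h v)%:R.
    move=> vi; rewrite /label (negPf good_i); case: pickP => [h' h'i|/(_ h)]; last first.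
      by move/negP; case.
    suff -> : h' = h by [].
    move: good_i; rewrite /exceptional negb_or -leqNgt => /andP[/card_le1_eqP h_uniq _].
    exact: h_uniq.
  rewrite (bigD1 h) //= labelE // eqxx /hub_label.
  rewrite [X in _ * (_ * X)](eq_bigr (fun v => mass h v / (codeg h v)%:R)); last first.
    by move=> v /andP[vi vh]; rewrite labelE // (negPf vh).
  rewrite [X in _ * (_ * X)](eq_bigl (mem (E i :\ h))); last first.
    by move=> v; rewrite !inE andbC.
  rewrite !mulrA divff ?gt_eqF // mul1r.
  rewrite -big_split big1 //= => v; rewrite !inE => /andP[_ vi].
  rewrite mulrA divfK ?gt_eqF ?mass_gt0 // divff //.
  by rewrite pnatr_eq0 -lt0n (codeg_gt0 hE vi).
have labelE v : label v i = if owns E a b v i then tau else N^-1 / tau ^+ k.-1.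
  rewrite /label (negPf good_i); case: pickP => // h hi.
  by have := no_h h; rewrite /= hi.
have := card_not_owners fo i; set X := [set v in _ | _].
have X_sub : X \subset E i by apply/subsetP => v; rewrite inE => /andP[].
rewrite (big_setID X) /= (setIidPr X_sub).
rewrite (eq_bigr (fun=> N^-1 / tau ^+ k.-1)); last first.
  by move=> v; rewrite inE labelE => /andP[_ /negPf->].
rewrite [X in _ -> _ <= _ * (_ * X)](eq_bigr (fun=> tau)); last first.
  by move=> v; rewrite !inE labelE => /andP[/[swap] ->]; rewrite negbK => ->.
rewrite !prodr_const cardsD (setIidPr X_sub) (fo_card fo).
case: #|X| => [|[|//]] _; first by rewrite expr0 mul1r subn0.
rewrite expr1 subn1 divfK ?gt_eqF ?exprn_gt0 // divff ?gt_eqF //.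
Qed.

(** The degrees sum to [k * f], and each high vertex accounts for at least [eps * f]. *)
Lemma card_high : #|high_verts|%:R <= k%:R / eps.
Proof.
rewrite ler_pdivlMr //.
have -> : k%:R = (k%:R * f%:R) / f%:R :> R by rewrite mulfK // gt_eqF.
rewrite ler_pdivlMr // -mulrA.
have -> : k%:R * f%:R = (\sum_v deg v)%:R :> R.
  by rewrite -natrM (sum_face_deg fo).
rewrite natr_sum (bigID (mem high_verts)) /= -[leLHS]addr0 lerD ?sumr_ge0 //.
rewrite mulrC mulr_natr -sumr_const ler_sum // => v; by rewrite inE.
Qed.

Lemma card_bad : #|[set i | exceptional i]|%:R <= K.
Proof.
pose faces2 (u v : V) := [set i | (u \in E i) && (v \in E i)].
pose P := [set p in finset.setX high_verts high_verts | p.1 != p.2].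
pose T1 := \bigcup_(p in P) faces2 p.1 p.2.
pose common (p : V * V) := [set v | (0 < codeg v p.1)%N && (0 < codeg v p.2)%N].
pose T2 := \bigcup_(p in P) \bigcup_(v in common p) \bigcup_(h in high_verts :\ v) faces2 v h.
have sub : [set i | exceptional i] \subset T1 :|: T2.
  apply/subsetP => i; rewrite !inE => /orP[/card_gt1P[u [v [ui vi uv]]]|].
    move: ui vi; rewrite !inE => /andP[ui uh] /andP[vi vh].
    apply/orP; left; apply/bigcupP; exists (u, v); last by rewrite inE ui.
    by rewrite inE in_setX !inE uh vh.
  case/andP => /set0Pn[h]; rewrite inE => /andP[hi hh] /exists_inP[v vi].
  case/andP => v_low /exists_inP[h1 h1h /exists_inP[h2 h2h /and3P[h12 vh1 vh2]]].
  apply/orP; right; apply/bigcupP; exists (h1, h2).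
    by rewrite inE in_setX h1h h2h.
  apply/bigcupP; exists v; first by rewrite inE vh1.
  apply/bigcupP; exists h; last by rewrite inE vi.
  by apply/setD1P; split=> //; apply: contraNneq v_low => <-.
have faces2_le u v : u != v -> (#|faces2 u v| <= 2)%N by exact: (face_codeg_le2 fo).
have P_le : (#|P| <= #|high_verts| ^ 2)%N.
  by rewrite -mulnn -cardsX subset_leq_card //; apply/subsetP => p; rewrite inE => /andP[].
have T1_le : (#|T1| <= #|high_verts| ^ 2 * 2)%N.
  apply: leq_trans (leq_mul P_le (leqnn _)).
  by apply: card_bigcup_le => p; rewrite inE => /andP[_]; apply: faces2_le.
have T2_le : (#|T2| <= #|high_verts| ^ 2 * (4 * k * (#|high_verts| * 2)))%N.
  apply: leq_trans (leq_mul P_le (leqnn _)).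
  apply: card_bigcup_le => p; rewrite inE => /andP[_ p12].
  apply: leq_trans (leq_mul (card_common_neighbors fo p12) (leqnn _)).
  apply: card_bigcup_le => v _.
  apply: (@leq_trans (#|high_verts :\ v| * 2)); last by rewrite leq_mul2r subset_leq_card ?orbT ?subD1set.
  by apply: card_bigcup_le => h; rewrite !inE eq_sym => /andP[vh _]; apply: faces2_le.
have : (#|[set i | exceptional i]| <= #|high_verts| ^ 2 * 2 + #|high_verts| ^ 2 * (4 * k * (#|high_verts| * 2)))%N.
  apply: leq_trans (subset_leq_card sub) _.
  exact: leq_trans (leq_card_setU _ _) (leq_add T1_le T2_le).
rewrite -(ler_nat R) => /le_trans; apply.
have s_ge0 : 0 <= #|high_verts|%:R :> R by [].
have s2 := lerXn2r 2 (s_ge0 : _ \in Num.nneg) (le_trans s_ge0 card_high : _ \in Num.nneg) card_high.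
have s3 := lerXn2r 3 (s_ge0 : _ \in Num.nneg) (le_trans s_ge0 card_high : _ \in Num.nneg) card_high.
have -> : (#|high_verts| ^ 2 * 2 + #|high_verts| ^ 2 * (4 * k * (#|high_verts| * 2)))%:R
    = 2 * #|high_verts|%:R ^+ 2 + 8 * k%:R * #|high_verts|%:R ^+ 3 :> R.
  by rewrite -!mulnn natrD !natrM; ring.
by apply: lerD; apply: ler_wpM2l => //; rewrite mulr_ge0.
Qed.

(** At most [k] owned faces cost [tau] each, and the fewer than [eps * f] faces of [v] cost at most
    [eta <= 1 / (f * tau ^ (k - 1))] each. Each part is at most [theta / 2]. *)
Lemma sum_light_labels v : v \notin high_verts ->
  \sum_(i | (v \in E i) && (E i :&: high_verts == finset.set0)) label v i <= theta.
Proof.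
rewrite inE -ltNge => v_low; set eta := N^-1 / tau ^+ k.-1.
have eta_ge0 : 0 <= eta by rewrite mulr_ge0 ?invr_ge0 ?exprn_ge0 ?ltW.
have label_le i : (v \in E i) && (E i :&: high_verts == finset.set0) ->
    label v i <= (if owns E a b v i then tau else 0) + eta.
  move=> /andP[_ /eqP no_high]; rewrite /label /exceptional no_high cards0 eqxx /=.
  case: pickP => [h|_]; first by rewrite inE.
  by case: ifP => _; rewrite ?add0r // lerDl.
apply: le_trans (ler_sum _ label_le) _; rewrite big_split /= -big_mkcondr /=.
have own_le : \sum_(i | (v \in E i) && (E i :&: high_verts == finset.set0) && owns E a b v i) tau
    <= theta / 2.
  apply: le_trans tau_le; rewrite sumr_const -[leLHS]mulr_natl ler_wpM2r ?(ltW tau_gt0) // ler_nat.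
  apply: leq_trans (card_owned fo v); apply/subset_leq_card/subsetP => i.
  by rewrite !inE => /andP[].
have deg_le : \sum_(i | (v \in E i) && (E i :&: high_verts == finset.set0)) eta <= theta / 2.
  rewrite sumr_const -[leLHS]mulr_natl; apply: (@le_trans _ _ ((deg v)%:R * eta)).
    rewrite ler_wpM2r // ler_nat; apply/subset_leq_card/subsetP => i.
    by rewrite !inE => /andP[].
  apply: (@le_trans _ _ (eps * f%:R * eta)); first by rewrite ler_wpM2r // ltW.
  rewrite /eta mulrA ler_pdivrMr ?exprn_gt0 //; apply: le_trans eps_le.
  by rewrite -mulrA ler_piMr ?(ltW eps_gt0) // ler_pdivrMr // mul1r.
lra.
Qed.

Lemma sum_bad_labels v : \sum_(i | (v \in E i) && exceptional i) label v i <= eps / 4.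
Proof.
apply: le_trans zeta_K.
rewrite (eq_bigr (fun=> zeta)); last by move=> i /andP[_ bad_i]; rewrite /label bad_i.
rewrite sumr_const -[leLHS]mulr_natr ler_wpM2l ?(ltW zeta_gt0) //.
apply: le_trans card_bad; rewrite ler_nat; apply/subset_leq_card/subsetP => i.
by rewrite !inE => /andP[].
Qed.

(** For a crowded vertex, every face with a high vertex is exceptional, hence cheap. Any other low
    vertex meets at most one high vertex [h], and its faces with [h] cost at most [mass h v]. Faces
    without [h] exist only if [v] strays, and then [kappa_theta] leaves room for them. *)
Lemma sum_labels_low v : v \notin high_verts -> \sum_(i | v \in E i) label v i <= 1.
Proof.
move=> v_low; rewrite (bigID (fun i => E i :&: high_verts == finset.set0)) /=.
have := sum_light_labels v_low; set light := \sum_(i | _ && _) _ => light_le.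
have [v_crowded|v_calm] := boolP (crowded v).
  set heavy := (X in _ + X); suff heavy_le : heavy <= eps / 4 by move: light_le heavy_le theta_le eps_le1; lra.
  apply: le_trans (sum_bad_labels v); rewrite /heavy.
  rewrite [leRHS](bigID (fun i => E i :&: high_verts != finset.set0)) /= -[leLHS]addr0 lerD //.
    rewrite le_eqVlt; apply/orP; left; apply/eqP/eq_bigl => i /=.
    case: (boolP (v \in E i)) => //= vi.
    case: (boolP (E i :&: high_verts == finset.set0)) => [_|h_i] /=; first by rewrite andbF.
    by rewrite andbT /exceptional h_i /=; apply/esym/orP; right; apply/exists_inP; exists v.
  by apply: sumr_ge0 => i _; apply: label_ge0.
have [i0|no_heavy] := pickP (fun i => (v \in E i) && (E i :&: high_verts != finset.set0)); last first.
  by rewrite [X in _ + X]big_pred0 // addr0 (le_trans light_le) //; move: theta_le; lra.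
case/andP=> vi0 /set0Pn[h]; rewrite inE => /andP[hi0 h_high].
have vh : v != h by apply: contraNneq v_low => ->.
have only_h i h' : v \in E i -> h' \in E i -> h' \in high_verts -> h' = h.
  move=> vi h'i h'_high; apply: contraNeq v_calm => h'h; rewrite /crowded v_low /=.
  apply/exists_inP; exists h' => //; apply/exists_inP; exists h => //.
  by rewrite h'h (codeg_gt0 vi) ?(codeg_gt0 vi0).
have heavy_h i : (v \in E i) && (E i :&: high_verts != finset.set0) -> h \in E i.
  case/andP=> vi /set0Pn[h']; rewrite inE => /andP[h'i h'_high].
  by rewrite -(only_h i h').
have codeg_pos : 0 < (codeg h v)%:R :> R by rewrite ltr0n (codeg_gt0 hi0).
have codeg_le : (codeg h v)%:R <= 2 :> R.
  by rewrite ler_nat (face_codeg_le2 fo) // eq_sym.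
have label_le i : (v \in E i) && (E i :&: high_verts != finset.set0) ->
    label v i <= mass h v / (codeg h v)%:R.
  move=> heavy; have hi := heavy_h i heavy; case/andP: heavy => vi _.
  rewrite /label; case: ifP => _.
    rewrite ler_pdivlMr //; apply: le_trans (mass_ge h v).
    apply: le_trans (ler_wpM2l (ltW zeta_gt0) codeg_le) _; move: zeta_le; lra.
  case: pickP => [h'|/(_ h)]; last by rewrite inE hi h_high.
  by rewrite inE => /andP[h'i h'_high]; rewrite (only_h i h') // (negPf vh).
have heavy_le : \sum_(i | (v \in E i) && (E i :&: high_verts != finset.set0)) label v i <= mass h v.
  apply: le_trans (ler_sum _ label_le) _.
  rewrite sumr_const -[leLHS]mulr_natr -mulrA -ler_pdivlMl ?mass_gt0 // mulVf ?gt_eqF ?mass_gt0 //.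
  rewrite ler_pdivrMl // mulr1 ler_nat; apply/subset_leq_card/subsetP => i heavy.
  by rewrite inE heavy_h //; case/andP: heavy.
move: heavy_le; rewrite /mass; case: ifP => [_|/existsP no_stray] heavy_le.
  by move: kappa_theta light_le heavy_le; lra.
suff -> : light = 0 by rewrite add0r.
apply: big_pred0 => i; apply/negP => /andP[vi /eqP no_high].
apply: no_stray; exists i; rewrite vi; apply/negP => hi.
by have := in_set0 h; rewrite -no_high inE hi h_high.
Qed.

(** A straying vertex lies on one of the [f - deg h] faces that miss [h]. Each of these has [k]
    vertices, and each such vertex shares at most two faces with [h]. *)
Lemma card_straying h :
  (#|[set i | (h \in E i) && [exists v in E i :\ h, strays h v]]| <= (f - deg h) * (k * 2))%N.
Proof.
have -> : (f - deg h)%N = #|~: [set i | h \in E i]| by rewrite cardsCs setCK card_ord.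
pose U := \bigcup_(j in ~: [set i | h \in E i]) \bigcup_(v in E j)
  [set i | (h \in E i) && (v \in E i)].
apply: (@leq_trans #|U|).
  apply/subset_leq_card/subsetP => i; rewrite inE => /andP[hi /exists_inP[v]].
  rewrite !inE => /andP[vh vi] /existsP[j /andP[vj hj]].
  apply/bigcupP; exists j; first by rewrite !inE.
  by apply/bigcupP; exists v; rewrite // inE hi.
apply: card_bigcup_le => j; rewrite !inE => hj; rewrite -(fo_card fo j).
apply: card_bigcup_le => v vj; apply: (face_codeg_le2 fo).
by apply: contraNneq hj => ->.
Qed.

(** For [s <= 2] one has [2 ^ s <= 1 + 3 / 2 * s], linear so that the sum over the faces is
    controlled by [sum_shared]. Straying multiplies by at most [1 + 1 / (8 * k)], and as
    [2 ^ s <= 4] this adds at most [1 / (2 * k)]. *)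
Lemma hub_label_le h i : h \in E i ->
  hub_label h i <= N^-1 * (1 + 3 / 2 * #|shared_with E h i|%:R
    + if [exists v in E i :\ h, strays h v] then (2 * k%:R)^-1 else 0).
Proof.
move=> hi; rewrite ler_wpM2l ?invr_ge0 ?(ltW N_gt0) // big_split /=.
have -> : \prod_(v in E i :\ h) (codeg h v)%:R = 2 ^+ #|shared_with E h i| :> R.
  rewrite (big_setID (shared_with E h i)) /= [X in _ * X]big1 ?mulr1; last first.
    move=> v; rewrite !inE => /andP[+ /andP[vh vi]]; rewrite vh vi /= -leqNgt => le1.
    suff -> : codeg h v = 1%N by [].
    by apply/eqP; rewrite eqn_leq le1 (codeg_gt0 hi).
  have /setIidPr -> : shared_with E h i \subset E i :\ h.
    by apply/subsetP => v; rewrite !inE => /and3P[-> -> _].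
  rewrite -prodr_const; apply: eq_bigr => v; rewrite inE => /and3P[_ vh cd].
  by congr (_%:R); apply/eqP; rewrite eqn_leq cd andbT (face_codeg_le2 fo) // eq_sym.
have s_le := po_shared fo hi; set s := #|_| in s_le *.
have k_gt0 : 0 < k%:R :> R by rewrite ltr0n (leq_trans _ k_ge3).
have pow_le : 2 ^+ s <= 1 + 3 / 2 * s%:R :> R.
  by move: s_le; case: (s) => [|[|[|//]]] _; rewrite ?expr0 ?expr1 ?expr2; lra.
have pow_le4 : 2 ^+ s <= 4 :> R.
  by move: s_le; case: (s) => [|[|[|//]]] _; rewrite ?expr0 ?expr1 ?expr2; lra.
have pow_ge0 : 0 <= 2 ^+ s :> R by rewrite exprn_ge0.
case: ifPn => [_|/exists_inPn calm]; last first.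
  rewrite big1 ?mulr1 ?addr0 // => v vi.
  by rewrite /mass (negPf (calm v vi)) invr1.
have mass_le : \prod_(v in E i :\ h) (mass h v)^-1 <= 1 + (8 * k%:R)^-1.
  apply: le_trans kappa_exp.
  have -> : (1 + kappa) ^+ k = \prod_(v in E i) (1 + kappa).
    by rewrite prodr_const (fo_card fo).
  rewrite [leRHS](bigD1 h hi) /= [X in _ * X](eq_bigl (fun v => v \in E i :\ h)); last first.
    by move=> v; rewrite !inE andbC.
  have kappa_ge1 : 1 <= 1 + kappa by rewrite lerDl ltW.
  rewrite -[leLHS]mul1r ler_pM //.
    by apply: prodr_ge0 => v _; rewrite invr_ge0 ltW.
  apply: ler_prod => v _; rewrite invr_ge0 (ltW (mass_gt0 h v)) /= /mass.
  by case: ifP => _; rewrite ?invrK ?invr1.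
apply: le_trans (ler_wpM2l pow_ge0 mass_le) _; rewrite mulrDr mulr1 lerD //.
rewrite (_ : (2 * k%:R)^-1 = 4 * (8 * k%:R)^-1) ?ler_wpM2r ?invr_ge0 ?mulr_ge0 //.
by field; rewrite gt_eqF.
Qed.

(* Each of the [f - deg h] faces that miss [h] makes at most [k] neighbours of *)
(* [h] stray, which costs less than the [4 / N] that its absence saves.        *)
Lemma sum_hub_labels h : (0 < deg h)%N ->
  \sum_(i | h \in E i) hub_label h i <= N^-1 * (f%:R + 3 * (deg h)%:R - 3).
Proof.
move=> d_gt0; apply: le_trans (ler_sum _ (@hub_label_le h)) _.
rewrite -mulr_sumr ler_wpM2l ?invr_ge0 ?(ltW N_gt0) //.
rewrite !big_split /= -big_mkcondr /= !sumr_const -mulr_sumr -natr_sum.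
have k_gt0 : 0 < k%:R :> R by rewrite ltr0n (leq_trans _ k_ge3).
have deg_le : (deg h <= f)%N by rewrite ltnW // no_hub.
have -> : #|[pred i | h \in E i]|%:R = (deg h)%:R :> R.
  by congr (_%:R); apply: eq_card => i; rewrite !inE.
have shared_le : (\sum_(i | h \in E i) #|shared_with E h i|)%:R <= 2 * (deg h)%:R - 2 :> R.
  rewrite -(natrM _ 2) lerBrDr -natrD ler_nat (leq_trans (leq_add (sum_shared fo h) (leqnn 2))) //.
  by rewrite -[X in (_ + X <= _)%N](muln1 2) -mulnDr addn1 prednK.
have stray_le : (2 * k%:R)^-1 *+ #|[pred i | (h \in E i) && [exists v in E i :\ h, strays h v]]|
    <= f%:R - (deg h)%:R :> R.
  rewrite -[leLHS]mulr_natr ler_pdivrMl ?mulr_gt0 // -natrB // -(natrM _ 2) -natrM ler_nat.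
  apply: leq_trans (leq_trans (card_straying h) _); last by rewrite mulnC [(k * 2)%N]mulnC.
  by apply/subset_leq_card/subsetP => i; rewrite !inE.
lra.
Qed.

(** If [h] is on no exceptional face, [deg h <= f - 1] turns [sum_hub_labels] into the bound 1. An
    exceptional face reveals a second high vertex, which shares at most two faces with [h]. Then [h]
    misses at least [eps * f - 2] faces, and this saving pays the [eps / 4] spent on exceptional
    faces. *)
Lemma sum_labels_high h : h \in high_verts -> \sum_(i | h \in E i) label h i <= 1.
Proof.
move=> h_high; have deg_pos : (0 < deg h)%N.
  by move: h_high; rewrite inE -(ltr0n R); apply: lt_le_trans; rewrite mulr_gt0.
have hub_ge0 i : 0 <= hub_label h i.
  apply: mulr_ge0; first by rewrite invr_ge0 ltW.
  by apply: prodr_ge0 => v _; rewrite mulr_ge0 ?invr_ge0 ?(ltW (mass_gt0 h v)).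
rewrite (bigID exceptional) /=.
have good_le : \sum_(i | (h \in E i) && ~~ exceptional i) label h i <=
    N^-1 * (f%:R + 3 * (deg h)%:R - 3).
  apply: le_trans (sum_hub_labels deg_pos).
  rewrite [leRHS](bigID exceptional) /= -[leLHS]add0r lerD ?sumr_ge0 // ler_sum // => i.
  case/andP=> hi good_i; rewrite /label (negPf good_i).
  case: pickP => [h' h'i|/(_ h)]; last by rewrite inE hi h_high.
  suff -> : h' = h by rewrite eqxx.
  move: good_i; rewrite /exceptional negb_or -leqNgt => /andP[/card_le1_eqP h_uniq _].
  by apply: h_uniq => //; rewrite inE hi.
have deg_lt : (deg h)%:R + 1 <= f%:R :> R by rewrite natr1 ler_nat; apply: no_hub.
have N_neq0 : N != 0 by rewrite gt_eqF.
have [i0 /andP[hi0 bad_i0]|no_bad] := pickP (fun i => (h \in E i) && exceptional i); last first.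
  rewrite big_pred0 // add0r; apply: le_trans good_le _.
  by rewrite ler_pdivrMl // mulr1 /N; lra.
have [h2 h2_high h2h] : exists2 h2, h2 \in high_verts & h2 != h.
  case/orP: bad_i0 => [/card_gt1P[u [v [ui vi uv]]]|].
    move: ui vi; rewrite !in_setI => /andP[ui u_high] /andP[vi v_high].
    by have [uh|] := eqVneq u h; [exists v; rewrite // -uh eq_sym|exists u].
  case/andP=> _ /exists_inP[v _ /andP[_ /exists_inP[u u_high /exists_inP[w w_high /and3P[uw _ _]]]]].
  by have [uh|] := eqVneq u h; [exists w; rewrite // -uh eq_sym|exists u].
have missed_ge : eps * f%:R - 2 <= f%:R - (deg h)%:R :> R.
  move: h2_high; rewrite inE => /le_trans h2_le; rewrite lerBlDr; apply: h2_le.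
  rewrite -natrB ?(ltnW (no_hub h)) // -natrD ler_nat.
  have -> : (f - deg h)%N = #|~: [set i | h \in E i]| by rewrite cardsCs setCK card_ord.
  rewrite /deg /face_deg -(cardsID [set i | h \in E i] [set i | h2 \in E i]) addnC leq_add //.
    by apply/subset_leq_card/subsetP => i; rewrite !inE => /andP[].
  apply: leq_trans (face_codeg_le2 fo h2h); apply/subset_leq_card/subsetP => i.
  by rewrite !inE.
have := sum_bad_labels h; move: good_le; set S1 := \sum_(i | _) _; set S2 := \sum_(i | _) _.
move=> good_le bad_le; apply: le_trans (lerD bad_le good_le) _.
have : N^-1 * (f%:R + 3 * (deg h)%:R - 3) <= 1 - eps / 4.
  by rewrite ler_pdivrMl // /N; move: eps_gt0 eps_large missed_ge; nra.
lra.
Qed.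

Lemma label_sum v : \sum_(i | v \in E i) label v i <= 1.
Proof.
by have [/sum_labels_high|/sum_labels_low] := boolP (v \in high_verts).
Qed.

End Labeling.

(** A repeated face would be contained in its attaching pair, too small for [k > 2]. *)
Lemma face_order_inj (V : finType) (k f : nat) (E : 'I_f -> {set V}) (a b : 'I_f -> V) :
  2 < k -> face_order k E a b -> injective E.
Proof.
move=> k_gt2 fo.
have not_lt (i j : 'I_f) : j < i -> E i = E j -> False.
  move=> ji Eij; have : E i \subset [set a i; b i].
    by apply/subsetP => v vi; apply: (fo_old fo ji) => //; rewrite -Eij.
  move/subset_leq_card; rewrite (fo_card fo) cards2 leqNgt => /negP[].
  by apply: leq_ltn_trans k_gt2; case: (_ == _).
move=> i j Eij; case: (ltngtP i j) => [ij|ji|/val_inj //].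
  by case: (not_lt j i).
by case: (not_lt i j).
Qed.

(** * The upper bound in the absence of a hub *)

Section UpperBound.
Variable R : realType.
Local Open Scope ring_scope.

(** Put [x = k * kappa = 1 / (16 * k)]. Bernoulli gives [1 - x <= (1 - kappa) ^ k], and
    [(1 + kappa) ^ k * (1 - kappa) ^ k <= 1], so the power is at most [1 / (1 - x) <= 1 + 2 * x]. *)
Lemma exp_le_of_small (kappa : R) (k : nat) : (0 < k)%N -> kappa = (16 * k%:R ^+ 2)^-1 ->
  (1 + kappa) ^+ k <= 1 + (8 * k%:R)^-1.
Proof.
move=> k_gt0 kappaE; have k_ge1 : 1 <= k%:R :> R by rewrite ler1n.
have k2_ge1 : 1 <= k%:R ^+ 2 :> R by rewrite exprn_ege1.
have kappa_gt0 : 0 < kappa by rewrite kappaE invr_gt0 mulr_gt0 // exprn_gt0 // ltr0n.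
have kappa_le : kappa <= 16^-1.
  by rewrite kappaE lef_pV2 ?posrE ?mulr_gt0 ?exprn_gt0 ?ltr0n // ler_peMr.
set x := (16 * k%:R)^-1 : R.
have x_gt0 : 0 < x by rewrite invr_gt0 mulr_gt0 // ltr0n.
have x_le : x <= 16^-1 by rewrite lef_pV2 ?posrE ?mulr_gt0 ?ltr0n // ler_peMr.
have xE : k%:R * kappa = x.
  by rewrite kappaE /x; field; rewrite gt_eqF // ltr0n.
have -> : (8 * k%:R)^-1 = 2 * x by rewrite /x; field; rewrite gt_eqF // ltr0n.
have bern : 1 - x <= (1 - kappa) ^+ k.
  apply: le_trans (bernoulli_le k _); last by move: kappa_le; lra.
  by rewrite mulrN xE.
have prod_le : (1 + kappa) ^+ k * (1 - x) <= 1.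
  apply: le_trans (ler_wpM2l _ bern) _; first by rewrite exprn_ge0 //; move: kappa_gt0; lra.
  rewrite -exprMn exprn_ile1 //; move: kappa_gt0 kappa_le; nra.
have : (1 + kappa) ^+ k * (1 - x) <= (1 + 2 * x) * (1 - x).
  apply: le_trans prod_le _; nra.
by rewrite ler_pM2r //; lra.
Qed.

Lemma hubless_spectral_radius_le (k : nat) : (2 < k)%N ->
  exists f1 : nat, forall (f : nat) (V : finType) (E : 'I_f -> {set V}) (a b : 'I_f -> V),
    (f1 <= f)%N -> polygon_order k E a b -> (forall v, (face_deg E v < f)%N) ->
    forall c : R, 0 <= c -> c ^+ k = 4 * f%:R - 6 ->
      spectral_radius R k [set E i | i : 'I_f] <= c.
Proof.
move=> k_gt2; have k_gt0 : (0 < k)%N by apply: leq_trans k_gt2.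
have k_pos : 0 < k%:R :> R by rewrite ltr0n.
have k_ge1 : 1 <= k%:R :> R by rewrite ler1n.
pose kappa : R := (16 * k%:R ^+ 2)^-1.
have kappa_gt0 : 0 < kappa by rewrite invr_gt0 mulr_gt0 // exprn_gt0.
have kappa_le1 : kappa <= 1.
  by rewrite invf_le1 ?mulr_gt0 ?exprn_gt0 // mulr_ege1 ?exprn_ege1 // ler1n.
pose theta := kappa / (1 + kappa).
have kappa1_gt0 : 0 < 1 + kappa by move: kappa_gt0; lra.
have theta_gt0 : 0 < theta by rewrite divr_gt0.
have theta_le : theta <= 1 / 2 by rewrite /theta ler_pdivrMr //; move: kappa_le1; lra.
have kappa_theta : (1 + kappa)^-1 + theta <= 1.
  by rewrite /theta -[X in X + _]mul1r -mulrDl divff ?gt_eqF.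
have kappa_half : 1 / 2 <= (1 + kappa)^-1.
  by rewrite -[leRHS]mul1r ler_pdivlMr //; move: kappa_le1; lra.
pose tau := theta / (2 * k%:R).
have tau_gt0 : 0 < tau by rewrite divr_gt0 // mulr_gt0.
have tau_le : k%:R * tau <= theta / 2.
  by rewrite (_ : k%:R * tau = theta / 2) //; rewrite /tau; field; rewrite gt_eqF.
have tau_le1 : tau <= 1.
  apply: (@le_trans _ _ (k%:R * tau)); first by rewrite ler_peMl // ltW.
  by apply: le_trans tau_le _; move: theta_le; lra.
pose eps := theta / 2 * tau ^+ k.-1.
have eps_gt0 : 0 < eps by apply: mulr_gt0; [rewrite divr_gt0 | rewrite exprn_gt0].
have eps_le1 : eps <= 1.
  have := exprn_ile1 k.-1 (ltW tau_gt0) tau_le1; have := exprn_gt0 k.-1 tau_gt0.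
  by rewrite /eps; move: theta_le theta_gt0; nra.
pose K : R := 2 * (k%:R / eps) ^+ 2 + 8 * k%:R * (k%:R / eps) ^+ 3.
have ke_ge0 : 0 <= k%:R / eps by rewrite divr_ge0 // ltW.
have K_ge0 : 0 <= K by rewrite /K addr_ge0 // mulr_ge0 ?exprn_ge0 // mulr_ge0.
pose zeta := eps / (4 * (K + 1)).
have K1_gt0 : 0 < 4 * (K + 1) by move: K_ge0; lra.
have zeta_gt0 : 0 < zeta by rewrite divr_gt0.
have zeta_le : zeta <= 1 / 4.
  by rewrite ler_pdivrMr //; move: eps_le1 K_ge0; lra.
have zeta_K : zeta * K <= eps / 4.
  rewrite /zeta mulrAC ler_pdivrMr //; move: eps_gt0 K_ge0; nra.
(* The three Archimedean bounds yield [eps_large], [tau_large] and [zeta_large]. All constants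
   depend on [k] only. *)
pose f1 := (2 + Num.bound (9 / (2 * eps)) + Num.bound (tau ^- k) + Num.bound (zeta ^- k))%N.
exists f1 => f V E a b f_ge fo no_hub c c_ge0 cE.
have large (x : R) : 0 <= x -> (Num.bound x <= f)%N -> x <= f%:R.
  by move=> x_ge0 xf; apply: ltW; apply: lt_le_trans (archi_boundP x_ge0) _; rewrite ler_nat.
have f_ge2 : (2 <= f)%N by apply: leq_trans f_ge; rewrite /f1 -!addnA leq_addr.
have N_ge : f%:R <= 4 * f%:R - 6 :> R by have : 2 <= f%:R :> R; [rewrite ler_nat|lra].
have eps_large : 9 <= 2 * eps * f%:R.
  have eps2_gt0 : 0 < 2 * eps by rewrite mulr_gt0.
  rewrite [leRHS]mulrC -(ler_pdivrMr _ _ eps2_gt0); apply: large; first by rewrite divr_ge0 // ltW.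
  by apply: leq_trans f_ge; rewrite /f1 -!addnA addnCA leq_addr.
have exp_large (x : R) : 0 < x -> (Num.bound (x ^- k) <= f)%N -> 1 <= (4 * f%:R - 6) * x ^+ k.
  move=> x_gt0 xf; apply: (@le_trans _ _ (f%:R * x ^+ k)); last by rewrite ler_wpM2r ?exprn_ge0 ?(ltW x_gt0).
  by rewrite -ler_pdivrMr ?exprn_gt0 // mul1r large // invr_ge0 exprn_ge0 // ltW.
have tau_large : 1 <= (4 * f%:R - 6) * tau ^+ k.
  by apply: exp_large => //; apply: leq_trans f_ge; rewrite /f1 -addnA addnCA leq_addr.
have zeta_large : 1 <= (4 * f%:R - 6) * zeta ^+ k.
  by apply: exp_large => //; apply: leq_trans f_ge; rewrite /f1 leq_addl.
have kappa_exp := exp_le_of_small k_gt0 (erefl kappa).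
have E_inj := face_order_inj k_gt2 fo.
have := @spectral_radius_le_labeling R k V [set E i | i : 'I_f] k_gt0 'I_f E
  (label k E a b kappa tau eps zeta) _ c E_inj (erefl _) (fo_card fo) _ _ _ c_ge0 cE.
apply.
- by move=> v i; apply: label_ge0 => //; rewrite ?ltW.
- by move=> v; apply: (label_sum fo no_hub _ _ _ _ theta_le) => //.
- by move=> i; apply: label_prod => //.
Qed.

End UpperBound.

(** * Hypergraphs with a hub *)

Section Hub.
Variables (V : finType) (k f : nat) (E : 'I_f -> {set V}) (a b : 'I_f -> V) (h : V).
Hypothesis fo : polygon_order k E a b.
Hypothesis covered : forall v, exists i, v \in E i.
Hypothesis card_V : #|V| = (k - 2) * f + 2.
Hypothesis hub : forall i, h \in E i.

Lemma hub_deg : face_deg E h = f.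
Proof. by rewrite /face_deg -[RHS]card_ord; apply: eq_card => i; rewrite !inE hub. Qed.

Lemma hub_codeg v : face_codeg E h v = face_deg E v.
Proof. by apply: eq_card => i; rewrite !inE hub. Qed.

Lemma face_deg_gt0 v : 0 < face_deg E v.
Proof. by have [i vi] := covered v; apply/card_gt0P; exists i; rewrite inE. Qed.

Lemma face_deg_le2 v : v != h -> face_deg E v <= 2.
Proof. by rewrite -hub_codeg eq_sym; apply: (face_codeg_le2 fo). Qed.

Lemma sum_face_deg_hub : \sum_(v | v != h) face_deg E v = k.-1 * f.
Proof.
by rewrite -subn1 mulnBl mul1n -(sum_face_deg fo) [in RHS](bigD1 h) //= hub_deg addKn.
Qed.

(** The [(k - 2) * f + 1] vertices other than the hub have degree 1 or 2 and total degree
    [(k - 1) * f]. So exactly [f - 1] have degree 2, each counted on two faces. *)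
Lemma hub_sum_shared : 1 < k -> 0 < f ->
  \sum_i #|shared_with E h i| = 2 * f.-1.
Proof.
move=> k_gt1 f_gt0.
under eq_bigr do rewrite -sum1_card.
rewrite (exchange_big_dep (fun u => (u != h) && (1 < face_deg E u))) /=; last first.
  by move=> i u _; rewrite inE hub_codeg => /andP[].
rewrite (eq_bigr (fun=> 2)); last first.
  move=> u /andP[uh du]; have := face_deg_le2 uh => du2.
  have -> : 2 = face_deg E u by apply/eqP; rewrite eqn_leq du du2.
  rewrite /face_deg -sum1_card; apply: eq_bigl => i.
  by rewrite !inE uh hub_codeg du !andbT.
have := sum_face_deg_hub.
rewrite (eq_bigr (fun v => 1 + (1 < face_deg E v))); last first.
  by move=> v /face_deg_le2; have := face_deg_gt0 v; case: (face_deg E v) => [|[|[|]]].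
rewrite big_split /= sum1_card -big_mkcondr /= sum1_card sum_nat_const.
have -> : #|[pred v | v != h]| = ((k - 2) * f + 2).-1.
  by rewrite -card_V -(cardC1 h); apply: eq_card => v; rewrite !inE.
have arith (k' f' m : nat) : 1 < k' -> 0 < f' ->
    ((k' - 2) * f' + 2).-1 + m = k'.-1 * f' -> m * 2 = 2 * f'.-1.
  by clear; case: k' => [//|[//|k']] _; case: f' => // f' _ /=; nia.
exact: arith.
Qed.

End Hub.

(** * The lower bound in the presence of a hub *)

Section LowerBound.
Variable R : realType.
Local Open Scope ring_scope.

Lemma bernoulli2_le (x : R) n : 0 <= x ->
  1 + n%:R * x + n%:R * (n%:R - 1) / 2 * x ^+ 2 <= (1 + x) ^+ n.
Proof.
move=> x_ge0; elim: n => [|n IHn]; first by rewrite !mul0r !addr0 expr0.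
have x1_ge0 : 0 <= 1 + x by lra.
rewrite [leRHS]exprS; apply: le_trans (ler_wpM2l x1_ge0 IHn).
have cube_ge0 : 0 <= n%:R * (n%:R - 1) / 2 * x ^+ 3.
  rewrite mulr_ge0 ?exprn_ge0 // divr_ge0 //.
  by case: (n) => [|m]; rewrite ?mul0r // mulr_ge0 // -natr1; have : 0 <= m%:R :> R by []; lra.
rewrite -natr1; move: cube_ge0; rewrite exprSr !expr2; nra.
Qed.

(** This is [k * (1 - 2 ^ (-1 / k)) < 3 / 4]. Otherwise [r >= 1 + x] with [x = 3 / (4 * k - 3)], and
    [(1 + x) ^ k > 2] by [bernoulli2_le]. The quadratic term is essential, since
    [1 + k * x <= 2]. *)
Lemma root2_lt (k : nat) (r : R) : (2 < k)%N -> 0 <= r -> r ^+ k = 2 ->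
  r * (4 * k%:R - 3) < 4 * k%:R.
Proof.
move=> k_gt2 r_ge0 rk; rewrite ltNge; apply/negP => r_ge.
have k_ge3 : 3 <= k%:R :> R by rewrite ler_nat.
pose x : R := 3 / (4 * k%:R - 3).
have den_gt0 : 0 < 4 * k%:R - 3 :> R by lra.
have x_gt0 : 0 < x by rewrite divr_gt0.
have r_ge_x : 1 + x <= r.
  have -> : 1 + x = 4 * k%:R / (4 * k%:R - 3) by rewrite /x; field; rewrite gt_eqF.
  by rewrite ler_pdivrMr.
have : (1 + x) ^+ k <= 2 by rewrite -rk lerXn2r // nnegrE; lra.
apply/negP; rewrite -ltNge; apply: lt_le_trans (bernoulli2_le k (ltW x_gt0)).
rewrite -subr_gt0.
have -> : 1 + k%:R * x + k%:R * (k%:R - 1) / 2 * x ^+ 2 - 2 =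
    (k%:R ^+ 2 / 2 + 21 / 2 * k%:R - 9) / (4 * k%:R - 3) ^+ 2.
  by rewrite /x; field; rewrite gt_eqF.
rewrite divr_gt0 ?exprn_gt0 //; nra.
Qed.

Lemma hub_spectral_radius_gt (V : finType) (k f : nat) (E : 'I_f -> {set V})
    (a b : 'I_f -> V) (h : V) (c : R) :
  (2 < k)%N -> (2 <= f)%N -> polygon_order k E a b -> (forall v, exists i, v \in E i) ->
  #|V| = ((k - 2) * f + 2)%N -> (forall i, h \in E i) ->
  0 <= c -> c ^+ k = 4 * f%:R - 6 ->
  c < spectral_radius R k [set E i | i : 'I_f].
Proof.
move=> k_gt2 f_ge2 fo covered card_V hub c_ge0 cE.
have k_gt0 : (0 < k)%N by apply: leq_trans k_gt2.
have f_gt0 : (0 < f)%N by apply: leq_trans f_ge2.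
have k_pos : 0 < k%:R :> R by rewrite ltr0n.
have f_pos : 0 < f%:R :> R by rewrite ltr0n.
have [A A_ge0 AE] := @exists_root R k k%:R^-1 k_gt0 (ltac:(by rewrite invr_ge0)).
have [p p_ge0 pE] := @exists_root R k (k%:R * f%:R)^-1 k_gt0 (ltac:(by rewrite invr_ge0 mulr_ge0)).
have [r r_ge0 rE] := @exists_root R k 2 k_gt0 (ltac:(by [])).
have r_lt := root2_lt k_gt2 r_ge0 rE.
have r_gt0 : 0 < r.
  by rewrite lt_def r_ge0 andbT; apply/eqP => r0; move: rE; rewrite r0 expr0n gtn_eqF //=; lra.
pose x v : R := if v == h then A else if (1 < face_deg E v)%N then r * p else p.
have x_ge0 v : 0 <= x v by rewrite /x; case: ifP => // _; case: ifP => // _; rewrite mulr_ge0.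
have x_pow v : v != h -> x v ^+ k = (face_deg E v)%:R / (k%:R * f%:R).
  move=> vh; have := face_deg_le2 fo hub vh; have := face_deg_gt0 covered v.
  rewrite /x (negPf vh); case: (face_deg E v) => [|[|[|]]] //= _ _.
    by rewrite pE div1r.
  by rewrite exprMn rE pE.
have x_sum : \sum_v x v ^+ k = 1.
  rewrite (bigD1 h) //= {1}/x eqxx AE (eq_bigr _ x_pow) -mulr_suml -natr_sum.
  rewrite (sum_face_deg_hub fo hub) natrM -subn1 natrB //.
  by field; rewrite !gt_eqF.
apply: lt_le_trans (spectral_radius_ge [set E i | i : 'I_f] k_gt0 x_ge0 x_sum).
have E_inj := face_order_inj k_gt2 fo.
rewrite /hypergraph_form big_imset /=; last by move=> ? ? _ _; apply: E_inj.
have prodE i : \prod_(v in E i) x v = A * p ^+ k.-1 * r ^+ #|shared_with E h i|.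
  have Ei_h : #|E i :\ h| = k.-1.
    by have := fo_card fo i; rewrite (cardsD1 h) hub => <-.
  rewrite (bigD1 h) //= {1}/x eqxx -mulrA; congr (_ * _).
  rewrite -Ei_h -prodr_const mulrC -prodr_const.
  rewrite (eq_bigl (fun v => v \in E i :\ h)); last by move=> v; rewrite !inE andbC.
  have sub : shared_with E h i \subset E i :\ h.
    by apply/subsetP => v; rewrite !inE => /and3P[-> -> _].
  rewrite [in X in _ = X * _](eq_bigl (fun v => (v \in E i :\ h) && (v \in shared_with E h i))).
    rewrite big_mkcondr -big_split; apply: eq_bigr => v; rewrite !inE => /andP[vh vi].
    by rewrite /x (negPf vh) vi (hub_codeg hub) /=; case: ifP; rewrite ?mul1r.
  by move=> v /=; case: (boolP (v \in shared_with E h i)) => [/(subsetP sub)->|_]; rewrite ?andbF.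
have sum_shared : \sum_i (#|shared_with E h i|%:R : R) = 2 * (f%:R - 1).
  by rewrite -natr_sum (hub_sum_shared fo covered card_V hub (ltnW k_gt2) f_gt0) natrM -subn1 natrB.
(* Bound [r ^ s] below by the line through its values at [s = 1] and [s = 2], using
   [(r - 1) ^ 2 >= 0] at [s = 0]. As the exponents sum to [2 * (f - 1)], the total is [T]. *)
pose T := (f%:R - 2) * r ^+ 2 + 2 * r.
have T_le : T <= \sum_i r ^+ #|shared_with E h i|.
  have -> : T = \sum_(i < f) (r + (#|shared_with E h i|%:R - 1) * (r ^+ 2 - r)).
    rewrite big_split /= sumr_const card_ord -mulr_suml sumrB sum_shared sumr_const card_ord.
    by rewrite -[X in _ = X + _]mulr_natr /T; ring.
  apply: ler_sum => i _; have := po_shared fo (hub i).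
  have := sqr_ge0 (r - 1); rewrite !expr2.
  by case: #|_| => [|[|[|//]]] sq_ge0 _; rewrite ?expr0 ?expr1 ?expr2; move: sq_ge0; lra.
have f2_ge0 : 0 <= f%:R - 2 :> R by rewrite subr_ge0 ler_nat.
have T_ge0 : 0 <= T by rewrite addr_ge0 // mulr_ge0 ?exprn_ge0.
set P := k%:R * (A * p ^+ k.-1 * T).
apply: (@lt_le_trans _ _ P); last first.
  rewrite ler_wpM2l // (eq_bigr _ (fun i _ => prodE i)) -mulr_sumr ler_wpM2l //.
  by rewrite mulr_ge0 ?exprn_ge0.
have P_ge0 : 0 <= P by rewrite !mulr_ge0 ?exprn_ge0.
rewrite -(@ltr_pXn2r _ k) // cE.
(* Chosen so that [T = r ^ 2 * f * (1 - y)]. Then [P ^ k = 4 * f * (1 - y) ^ k], and Bernoulli's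
   inequality loses only [8 * k * (r - 1) / r < 6]. *)
pose y := 2 * (r - 1) / (f%:R * r).
have -> : P ^+ k = 4 * f%:R * (1 - y) ^+ k.
  have TE : T = r * (r * (f%:R * (1 - y))).
    by rewrite /T /y; field; rewrite !gt_eqF.
  rewrite /P TE !exprMn AE rE -exprM mulnC exprM pE exprVn.
  have fk : f%:R ^+ k = f%:R * f%:R ^+ k.-1 :> R by rewrite -exprS prednK.
  have kk : k%:R ^+ k = k%:R * k%:R ^+ k.-1 :> R by rewrite -exprS prednK.
  by rewrite exprMn fk kk; field; rewrite !gt_eqF ?exprn_gt0.
have r_ge1 : 1 <= r.
  by rewrite leNgt; apply/negP => r_lt1; have := exprn_ile1 k r_ge0 (ltW r_lt1); rewrite rE; lra.
have y_le1 : y <= 1.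
  have f_r : 2 * r <= f%:R * r by rewrite ler_wpM2r // ler_nat.
  by rewrite /y ler_pdivrMr ?mulr_gt0 //; lra.
have bern : 1 - k%:R * y <= (1 - y) ^+ k.
  by rewrite -mulrN; apply: bernoulli_le; lra.
have f4_gt0 : 0 < 4 * f%:R :> R by rewrite mulr_gt0.
apply: lt_le_trans (ler_wpM2l (ltW f4_gt0) bern).
have -> : 4 * f%:R * (1 - k%:R * y) = 4 * f%:R - 8 * (k%:R * (r - 1) / r).
  by rewrite /y; field; rewrite !gt_eqF.
have : k%:R * (r - 1) / r < 3 / 4 by rewrite ltr_pdivrMr //; lra.
lra.
Qed.

End LowerBound.

(** * Facial walks of a k-angulation *)

Lemma sum_card_porbits (T : finType) (s : {perm T}) : \sum_(A in porbits s) #|A| = #|T|.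
Proof.
under eq_bigr do rewrite -sum1_card.
rewrite (exchange_big_dep predT) //= -sum1_card; apply: eq_bigr => x _.
rewrite (big_pred1 (porbit s x)) // => A /=.
apply/andP/eqP => [[/imsetP[y _ ->] xA]|->]; last by rewrite imset_f ?porbit_id.
by apply/eqP; rewrite eq_porbit_mem porbit_sym.
Qed.

Lemma dart_eq (V : finType) (G : sgraph V) (d e : dart G) :
  dtail d = dtail e -> dhead d = dhead e -> d = e.
Proof.
case: d e => [[u v] uv] [[u' v'] uv']; rewrite /dtail /dhead /= => uE vE.
by apply: val_inj; rewrite /= uE vE.
Qed.

Section PlaneGraph.
Variables (V : finType) (G : plane_graph V).
Notation rot := (pg_rot G).
Notation phi := (face_perm rot).
Notation O := (pg_outer G).
Notation tail := (@dtail V G).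
Notation head := (@dhead V G).
Notation rev := (@drev V G).
Notation face := (porbit phi).
Implicit Types d e : dart G.

Lemma face_permE d : phi d = rot (rev d).
Proof. by rewrite /face_perm permM permE. Qed.

Lemma face_perm_rev d : phi (rev d) = rot d.
Proof. by rewrite face_permE drevK. Qed.

Lemma tail_rev d : tail (rev d) = head d. Proof. by []. Qed.
Lemma head_rev d : head (rev d) = tail d. Proof. by []. Qed.

Lemma tail_neq_head d : tail d != head d.
Proof.
case: d => [[u v] /= uv]; rewrite /dtail /dhead /=; apply: contraTneq uv => ->.
by rewrite adj_irr.
Qed.

Lemma tail_rot d : tail (rot d) = tail d.
Proof. by apply/eqP; rewrite -pg_rotP -[rot d]/((rot ^+ 1)%g d) mem_porbit. Qed.

Lemma tail_face_perm d : tail (phi d) = head d.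
Proof. by rewrite face_permE tail_rot. Qed.

Lemma face_mem_perm d e : (phi d \in face e) = (d \in face e).
Proof.
by rewrite porbit_sym [RHS]porbit_sym -[phi d]/((phi ^+ 1)%g d) porbit_perm.
Qed.

Lemma outerE : exists o, O = face o.
Proof. by have /imsetP[o _ ->] := pg_outerP G; exists o. Qed.

Lemma mem_outer_face d e : d \in O -> (e \in O) = (e \in face d).
Proof.
have [o ->] := outerE => dO; suff -> : face d = face o by [].
by apply/eqP; rewrite eq_porbit_mem.
Qed.

Lemma outer_face_perm d : (phi d \in O) = (d \in O).
Proof. by have [o ->] := outerE; rewrite face_mem_perm. Qed.

Lemma face_interior d : d \notin O -> face d \in interior_faces G.
Proof.
move=> dO; rewrite !inE imset_f // andbT; apply: contraNneq dO => <-.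
exact: porbit_id.
Qed.

Lemma interior_faceE F : F \in interior_faces G -> exists2 d, d \notin O & F = face d.
Proof.
rewrite !inE => /andP[FO /imsetP[d _ FE]]; exists d => //; rewrite FE in FO *.
by apply: contra FO => dO; rewrite eq_sym; have [o oE] := outerE; rewrite oE eq_sym eq_porbit_mem -oE.
Qed.

Lemma notin_outer_face d e : d \notin O -> e \in face d -> e \notin O.
Proof.
by move=> dO ed; apply: contra dO => eO; rewrite (mem_outer_face _ eO) porbit_sym.
Qed.

Section KAngulation.
Variable k : nat.
Hypothesis k_gt2 : 2 < k.
Hypothesis kang : kangulation G k.

Lemma outer_at v : exists2 o, o \in O & tail o = v.
Proof.
have [_ outerp _ _] := kang.
have : v \in face_verts O by rewrite outerp inE.
by case/imsetP=> o oO ->; exists o.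
Qed.

Lemma outer_inj d e : d \in O -> e \in O -> tail d = tail e -> d = e.
Proof. by have [_ _ [_ inj] _] := kang; apply: inj. Qed.

Lemma interior_inj d e e' : d \notin O -> e \in face d -> e' \in face d ->
  tail e = tail e' -> e = e'.
Proof.
by have [_ _ _ inj] := kang => dO; have [[_ inj_d] _] := inj _ (face_interior dO); apply: inj_d.
Qed.

Lemma card_interior d : d \notin O -> #|face d| = k.
Proof. by have [_ _ _ inj] := kang => dO; have [_] := inj _ (face_interior dO). Qed.

Lemma card_face_verts d : d \notin O -> #|face_verts (face d)| = k.
Proof.
move=> dO; rewrite card_in_imset ?card_interior // => e e' ed e'd.
exact: (interior_inj dO).
Qed.

Lemma outer_card : #|O| = #|V|.
Proof.
have [_ outerp [_ inj] _] := kang.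
by rewrite -(card_in_imset inj) -/(face_verts O) outerp cardsT.
Qed.

(* If both darts of an edge were outer, the outer face would consist of these *)
(* two darts alone, the tail of an outer dart determining it.                 *)
Lemma rev_notin_outer d : d \in O -> rev d \notin O.
Proof.
move=> dO; apply/negP => rO.
have rot_d : rot d = d.
  by apply: outer_inj; rewrite ?tail_rot // -face_perm_rev outer_face_perm.
have phi_d : phi d = rev d.
  by apply: outer_inj; rewrite ?tail_face_perm ?outer_face_perm.
have phi_r : phi (rev d) = d by rewrite face_perm_rev.
have [_ _ [O_gt2 _] _] := kang.
have : O \subset [set d; rev d].
  apply/subsetP => e; rewrite (mem_outer_face _ dO) => /porbitP[i ->].
  elim: i => [|i]; first by rewrite expg0 perm1 !inE eqxx.
  by rewrite expgSr permM !inE => /orP[]/eqP->; rewrite ?phi_d ?phi_r eqxx ?orbT.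
move/subset_leq_card; rewrite leqNgt cards2; case/negP.
by apply: leq_ltn_trans O_gt2; case: (_ == _).
Qed.

(** Counting darts by faces gives [#|V|] outer ones and [k] for each interior face; Euler's formula
    does the rest. *)
Lemma card_verts : #|V| = (k - 2) * #|interior_faces G| + 2.
Proof.
have := pg_euler G; rewrite -(sum_card_porbits phi) (bigD1 O) ?pg_outerP //= outer_card.
rewrite (eq_bigl (mem (interior_faces G))); last first.
  by move=> F; rewrite !inE andbC.
rewrite (eq_bigr (fun=> k)); last by move=> F /interior_faceE[d dO ->]; apply: card_interior.
rewrite sum_nat_const /interior_faces (cardsD1 O (face_sets rot)) pg_outerP.
by move: #|_ :\ _| #|V| k_gt2; clear=> f n k_gt2; nia.
Qed.

Section Closed.
Variable A : {set dart G}.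
Hypothesis A_outer : forall d, d \in A -> d \notin O.
Hypothesis A_face : forall d e, d \in A -> e \in face d -> e \in A.
Hypothesis A_rev : forall d, d \in A -> rev d \notin O -> rev d \in A.

Lemma closed_rot d : d \in A -> (rot d \in A) || (rot d \in O).
Proof.
move=> dA; rewrite -face_perm_rev.
case: (boolP (rev d \in O)) => [rO|/(A_rev dA) rA]; first by rewrite outer_face_perm rO orbT.
by rewrite (A_face rA) // face_mem_perm porbit_id.
Qed.

Lemma closed_rot_inv d : rot d \in A -> (d \in A) || (d \in O).
Proof.
rewrite -face_perm_rev => pA.
have rA : rev d \in A by apply: A_face pA _; rewrite -face_mem_perm porbit_id.
case: (boolP (d \in O)) => [|dO]; rewrite ?orbT //.
by have := A_rev rA; rewrite drevK => ->.
Qed.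

(* Turning around a vertex, the interior faces follow one another across      *)
(* interior edges, and the outer face interrupts them only once.              *)
Lemma closed_vertex d e : d \in A -> tail e = tail d -> e \notin O -> e \in A.
Proof.
move=> dA tail_e eO; have [o oO tail_o] := outer_at (tail d).
have orbit_o x : tail x = tail d -> exists i, x = (rot ^+ i)%g o.
  by move=> tail_x; apply/porbitP; rewrite pg_rotP tail_x tail_o.
have tail_i i : tail ((rot ^+ i)%g o) = tail d.
  by rewrite -tail_o; apply/eqP; rewrite -pg_rotP mem_porbit.
have uniq_o i : (rot ^+ i)%g o \in O -> (rot ^+ i)%g o = o.
  by move=> iO; apply: outer_inj => //; rewrite tail_i tail_o.
case: (boolP ((rot o \in A) || (rot o \in O))) => [rot_o|rot_o].
  have all_A i : ((rot ^+ i)%g o \in A) || ((rot ^+ i)%g o \in O).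
    elim: i => [|i /orP[iA|/uniq_o iE]]; first by rewrite expg0 perm1 oO orbT.
      by rewrite expgSr permM closed_rot.
    by rewrite expgSr permM iE.
  have [i eE] := orbit_o e tail_e; have := all_A i.
  by rewrite -eE (negPf eO) orbF.
have none_A i : (rot ^+ i)%g o \notin A.
  elim: i => [|i]; first by rewrite expg0 perm1; apply: contraL oO; apply: A_outer.
  rewrite expgSr permM => iA; apply: contra rot_o => /[dup] rA /closed_rot_inv.
  by rewrite (negPf iA) /= => /uniq_o <-; rewrite rA.
have [i dE] := orbit_o d erefl; have := none_A i.
by rewrite -dE dA.
Qed.

(** This is the connectedness of the dual graph on the interior faces. By [closed_vertex], a vertex
    touched by [A] has all its interior darts in [A], and this property spreads along the edges of
    the connected graph [G]. *)
Lemma closed_all d e : d \in A -> e \notin O -> e \in A.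
Proof.
move=> dA eO; suff [x xA tail_x] : exists2 x, x \in A & tail x = tail e.
  by apply: closed_vertex xA _ eO.
pose X := [set v | [exists x in A, tail x == v]].
have X_step u v : adj G u v -> u \in X -> v \in X.
  move=> uv; rewrite !inE => /exists_inP[x xA /eqP xu].
  pose y : dart G := exist _ (u, v) uv.
  have yu : tail y = u by []. have yv : head y = v by [].
  case: (boolP (y \in O)) => [yO|yO].
    have rA : rev y \in A.
      apply: (@A_face (phi (rev y))); last by rewrite -face_mem_perm porbit_id.
      apply: closed_vertex xA _ _; first by rewrite tail_face_perm head_rev yu xu.
      by rewrite outer_face_perm rev_notin_outer.
    by apply/exists_inP; exists (rev y).
  have yA : y \in A by apply: closed_vertex xA _ yO; rewrite yu.
  apply/exists_inP; exists (phi y); last by rewrite tail_face_perm.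
  by apply: A_face yA _; rewrite face_mem_perm porbit_id.
have dX : tail d \in X by rewrite inE; apply/exists_inP; exists d.
suff : tail e \in X by rewrite inE => /exists_inP[x xA /eqP xe]; exists x.
have /connectP[p pP ->] := pg_connected G (tail d) (tail e).
elim: p (tail d) dX pP => //= v p IHp u uX /andP[uv vp].
by apply: IHp vp; apply: X_step uX.
Qed.

End Closed.

End KAngulation.
End PlaneGraph.

(** * Gluing the faces one after another *)

Section KAngulationOrder.
Variables (V : finType) (G : plane_graph V) (k : nat).
Hypothesis k_gt2 : 2 < k.
Hypothesis kang : kangulation G k.
Notation rot := (pg_rot G).
Notation phi := (face_perm rot).
Notation O := (pg_outer G).
Notation tail := (@dtail V G).
Notation head := (@dhead V G).
Notation rev := (@drev V G).
Notation face := (porbit phi).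
Implicit Types d e : dart G.

(** A face is represented by its dart on the edge along which it is glued. *)
Definition attached (s : seq (dart G)) : Prop :=
  [/\ uniq (map face s), {in s, forall d, d \notin O} &
      forall i, 0 < i < size s -> forall d0,
        exists2 j, j < i & rev (nth d0 s i) \in face (nth d0 s j)].

(** If no interior edge led out of the listed faces, their darts would be closed in the sense of
    [closed_all] and would include [d]. *)
Lemma attached_rcons s d : attached s -> 0 < size s -> d \notin O -> face d \notin map face s ->
  exists c, attached (rcons s c).
Proof.
move=> [s_uniq s_int s_att] s_gt0 dO d_new.
pose A := [set e | face e \in map face s].
have faceE (e e' : dart G) : e' \in face e -> face e' = face e.
  by move=> e'e; apply/eqP; rewrite eq_porbit_mem.
have memA e : reflect (exists2 c, c \in s & e \in face c) (e \in A).
  rewrite inE; apply: (iffP mapP) => [[c cs ec]|[c cs /faceE ec]]; exists c => //.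
  by rewrite -ec porbit_id.
have A_outer e : e \in A -> e \notin O.
  by case/memA => c /s_int cO; apply: notin_outer_face.
have A_face e e' : e \in A -> e' \in face e -> e' \in A.
  by rewrite !inE => eA /faceE ->.
have [/existsP[e /and3P[eA rO rA]]|no_step] :=
    boolP [exists e, [&& e \in A, rev e \notin O & rev e \notin A]].
  exists (rev e); split.
  - by rewrite map_rcons rcons_uniq s_uniq andbT; move: rA; rewrite inE.
  - by move=> c; rewrite mem_rcons inE => /predU1P[->|/s_int].
  - move=> i /andP[i_gt0]; rewrite size_rcons ltnS leq_eqVlt => /predU1P[->|i_lt] d0.
      rewrite nth_rcons ltnn eqxx drevK.
      have [c cs ec] := memA e eA; exists (index c s); first by rewrite index_mem.
      by rewrite nth_rcons index_mem cs nth_index.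
    have [|j ji jE] := s_att i _ d0; first by rewrite i_gt0.
    by exists j => //; rewrite !nth_rcons i_lt (ltn_trans ji i_lt).
have A_rev e : e \in A -> rev e \notin O -> rev e \in A.
  move=> eA rO; apply: contraNT no_step => rA.
  by apply/existsP; exists e; rewrite eA rO.
case: s s_gt0 @A d_new {s_uniq s_int s_att} memA A_outer A_face {no_step} A_rev => // c s _ A d_new memA *.
have cA : c \in A by apply/memA; exists c; rewrite ?mem_head ?porbit_id.
have : d \in A by apply: (closed_all kang) cA dO.
by rewrite inE (negPf d_new).
Qed.

Lemma exists_attached m : 0 < m <= #|interior_faces G| ->
  exists2 s, size s = m & attached s.
Proof.
case/andP; elim: m => [//|[|m] IHm] _ m_le.
  have /card_gt0P[F /interior_faceE[d dO _]] := m_le.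
  exists [:: d] => //; split=> //; first by move=> e; rewrite inE => /eqP ->.
  by move=> [|i] //=; rewrite ltnS ltn0.
have [s size_s s_att] := IHm isT (ltnW m_le).
have [_ s_int _] := s_att.
have /subsetPn[F /interior_faceE[d dO ->] d_new] : ~~ (interior_faces G \subset map face s).
  apply: contraL m_le => /subset_leq_card le_s; rewrite -leqNgt (leq_trans le_s) //.
  by rewrite (leq_trans (card_size _)) // size_map size_s.
have [|c c_att] := attached_rcons s_att _ dO d_new; first by rewrite size_s.
by exists (rcons s c); rewrite ?size_rcons ?size_s.
Qed.

Lemma interior_faces_gt0 : 0 < #|interior_faces G|.
Proof.
have [[V_gt2 _ _] _ _ _] := kang.
have /card_gt0P[v _] : 0 < #|V| by apply: ltn_trans V_gt2.
have [o oO _] := outer_at kang v.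
by apply/card_gt0P; exists (face (rev o)); rewrite face_interior ?(rev_notin_outer kang).
Qed.

(** Each face after the first brings at most [k - 2] new vertices, because its gluing edge is old.
    The count [(k - 2) * f + 2] forces equality throughout, so the ends of that edge are the only
    old vertices. *)
Theorem kangulation_face_order :
  exists (E : 'I_#|interior_faces G| -> {set V}) (a b : 'I_#|interior_faces G| -> V),
    [/\ polygon_order k E a b, face_hypergraph G = [set E i | i : 'I_#|interior_faces G|]
      & forall v, exists i, v \in E i].
Proof.
have f_gt0 := interior_faces_gt0; have n_card := card_verts k_gt2 kang.
have [|s] := @exists_attached #|interior_faces G|; first by rewrite f_gt0 leqnn.
have facesE F : F \in interior_faces G -> #|interior_faces G| = size s ->
    attached s -> F \in map face s.
  move=> F_int f_s [s_uniq s_int _].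
  have sub : [set F in map face s] \subset interior_faces G.
    by apply/subsetP => F'; rewrite inE => /mapP[d /s_int dO ->]; apply: face_interior.
  have eq_s : [set F in map face s] = interior_faces G.
    apply/eqP; rewrite eqEcard sub f_s -(size_map face) -(card_uniqP s_uniq).
    by apply/eq_leq/eq_card => F'; rewrite inE.
  by move: F_int; rewrite -eq_s inE.
move: n_card facesE f_gt0; set f := #|_| => n_card facesE f_gt0 size_s s_att.
have [s_uniq s_int s_par] := s_att.
have d0 : dart G by case: (s) size_s f_gt0 => [<- //|d].
pose c (i : 'I_f) := nth d0 s i.
have c_in i : c i \in s by rewrite mem_nth // size_s.
have cO i : c i \notin O by apply: s_int.
have c_inj i j : face (c i) = face (c j) -> i = j.
  move=> eq_ij; apply/val_inj/eqP; rewrite /= -(nth_uniq (face d0) _ _ s_uniq) ?size_map ?size_s //.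
  by rewrite !(nth_map d0) ?size_s //; apply/eqP.
pose E i := face_verts (face (c i)).
have tail_in i e : e \in face (c i) -> tail e \in E i by apply: imset_f.
have head_in i e : e \in face (c i) -> head e \in E i.
  by move=> ei; rewrite -tail_face_perm; apply: tail_in; rewrite face_mem_perm.
have par (i : 'I_f) : 0 < i -> exists2 p : 'I_f, p < i & rev (c i) \in face (c p).
  move=> i_gt0; have [|p pi pE] := s_par i _ d0; first by rewrite i_gt0 size_s ltn_ord.
  by exists (Ordinal (ltn_trans pi (ltn_ord i))).
have E_card (i : 'I_f) : #|E i| = k by apply: card_face_verts.
have covered v : exists i, v \in E i.
  have [o oO <-] := outer_at kang v.
  have /mapP[d ds dE] := facesE _ (face_interior (rev_notin_outer kang oO)) (esym size_s) s_att.
  have d_lt : index d s < f by rewrite -size_s index_mem.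
  exists (Ordinal d_lt); rewrite -[o]drevK tail_rev; apply: head_in.
  by rewrite /c /= nth_index // -dE porbit_id.
pose a i := tail (c i); pose b i := head (c i).
have ab (i : 'I_f) : [/\ a i \in E i, b i \in E i & a i != b i].
  by split; [apply: tail_in|apply: head_in|apply: tail_neq_head]; rewrite ?porbit_id.
have ab_par (i : 'I_f) : 0 < i -> exists2 p : 'I_f, p < i & (a i \in E p) && (b i \in E p).
  by case/par => p pi pE; exists p; rewrite // (head_in _ _ pE) (tail_in _ _ pE).
pose U (i : 'I_f) := \bigcup_(j < f | j < i) E j.
have old_ge (i : 'I_f) : 0 < i -> #|E i :\: U i| <= k - 2.
  move=> i_gt0; have [ai bi neq_ab] := ab i.
  have [p pi /andP[ap bp]] := ab_par i i_gt0.
  rewrite -(E_card i) cardsD leq_sub2l //.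
  apply: leq_trans (subset_leq_card (_ : [set a i; b i] \subset _)).
    by rewrite cards2 neq_ab.
  apply/subsetP => v /set2P[]->; rewrite inE ?ai ?bi; apply/bigcupP; by exists p.
have n_le : #|V| <= \sum_(i < f) #|E i :\: U i|.
  rewrite -cardsT.
  have -> : [set: V] = \bigcup_(i < f) (E i :\: U i).
    apply/setP => v; rewrite inE; apply/esym/bigcupP; have [i0 vi0] := covered v.
    have [i /= vi i_min] := arg_minnP (fun i : 'I_f => i : nat) (vi0 : [pred i | v \in E i] i0).
    exists i => //; rewrite inE vi andbT; apply/bigcupP => -[j ji vj].
    by have := i_min j vj; rewrite leqNgt ji.
  elim/big_rec2: _ => [|i m A _ IH]; first by rewrite cards0.
  by rewrite (leq_trans (leq_card_setU _ _)) // leq_add2l.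
pose i0 := Ordinal f_gt0.
have old (i j : 'I_f) v : j < i -> v \in E i -> v \in E j -> v \in [set a i; b i].
  move=> ji vi vj; apply: contraT => v_new; have i_gt0 : 0 < i by apply: leq_ltn_trans ji.
  have [ai bi neq_ab] := ab i; have [p pi /andP[ap bp]] := ab_par i i_gt0.
  have lt_i : #|E i :\: U i| <= k - 3.
    rewrite -(E_card i) cardsD leq_sub2l //.
    apply: leq_trans (subset_leq_card (_ : v |: [set a i; b i] \subset _)).
      by rewrite cardsU1 v_new cards2 neq_ab.
    apply/subsetP => w /setU1P[->|/set2P[]->]; rewrite inE ?ai ?bi ?vi; apply/bigcupP;
      by [exists j | exists p].
  have neq_i : i != i0 by rewrite -val_eqE /= -lt0n.
  have : #|V| <= k + (k - 3 + (f - 2) * (k - 2)).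
    apply: leq_trans n_le _; rewrite (bigD1 i0) //= (bigD1 i) //=.
    apply: leq_add; first by rewrite -(E_card i0) subset_leq_card // subsetDl.
    apply: leq_add => //.
    have -> : f - 2 = #|[pred j : 'I_f | (j != i0) && (j != i)]|.
      have card_i : 2 + #|[pred j : 'I_f | (j != i0) && (j != i)]| = f.
        rewrite -[RHS]card_ord -(cardC (pred2 i0 i)) card2 eq_sym neq_i; congr (_ + _).
        by apply: eq_card => l; rewrite !inE negb_or.
      by rewrite -[X in X - _]card_i addKn.
    rewrite -sum_nat_const leq_sum // => l /andP[l0 _]; apply: old_ge.
    by rewrite lt0n; apply: contraNneq l0 => l0; apply/eqP/val_inj.
  rewrite n_card; have f_gt1 : 1 < f by apply: leq_ltn_trans i_gt0 (ltn_ord i).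
  have arith (k' f' : nat) : 2 < k' -> 1 < f' ->
      (k' - 2) * f' + 2 <= k' + (k' - 3 + (f' - 2) * (k' - 2)) -> false.
    by clear; nia.
  exact: arith.
(* Distinct faces with the same attaching pair would lie on the two sides of one edge, each being
   the parent of the other, hence earlier. *)
have inj (i j : 'I_f) : 0 < i -> 0 < j -> [set a i; b i] = [set a j; b j] -> i = j.
  move=> i_gt0 j_gt0 eq_ab; have [_ _ neq_i] := ab i; have [_ _ neq_j] := ab j.
  have /set2P[aE|aE] : a i \in [set a j; b j] by rewrite -eq_ab set21.
    have /set2P[bE|bE] : b i \in [set a j; b j] by rewrite -eq_ab set22.
      by rewrite aE bE eqxx in neq_i.
    by apply: c_inj; rewrite (dart_eq aE bE).
  have bE : b i = a j.
    have /set2P[//|bE] : b i \in [set a j; b j] by rewrite -eq_ab set22.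
    by rewrite aE bE eqxx in neq_i.
  have cE : c i = rev (c j) by apply: dart_eq; rewrite ?tail_rev ?head_rev.
  have faceE l p : rev (c l) \in face (c p) -> face (rev (c l)) = face (c p).
    by move=> lp; apply/eqP; rewrite eq_porbit_mem.
  have [p pi /faceE pE] := par i i_gt0; have [q qj /faceE qE] := par j j_gt0.
  have jp : j = p by apply: c_inj; rewrite -pE cE drevK.
  have iq : i = q by apply: c_inj; rewrite -qE -cE.
  by move: pi qj; rewrite -jp -iq => /ltn_trans lt /lt; rewrite ltnn.
have fo : face_order k E a b.
  by split=> // i; have [ai bi neq_ab] := ab i; rewrite ?ai ?bi.
exists E, a, b; split=> //; last first.
  apply/setP => X; apply/imsetP/imsetP => [[F F_int ->]|[i _ ->]]; last first.
    by exists (face (c i)); rewrite ?face_interior.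
  have /mapP[d ds ->] := facesE _ F_int (esym size_s) s_att.
  have d_lt : index d s < f by rewrite -size_s index_mem.
  by exists (Ordinal d_lt); rewrite /E /c /= ?nth_index.
(* If [h] and [u] share the faces [i] and [j], they form the attaching pair of the later one, whose
   parent must be the other. So they span a boundary edge of face [i], and [u] is the successor or
   the predecessor of [h] there. *)
split=> // i h hi; have /imsetP[e1 e1i hE] := hi.
pose e2 := (phi^-1)%g e1.
apply: leq_trans (_ : #|[set head e1; tail e2]| <= 2); last by rewrite cards2; case: (_ == _).
apply/subset_leq_card/subsetP => u; rewrite inE => /and3P[ui neq_uh cd].
have neq_hu : h != u by rewrite eq_sym.
have [j ji /andP[hj uj]] : exists2 j, j != i & (h \in E j) && (u \in E j).
  move: cd; rewrite /face_codeg (cardsD1 i) inE hi ui add1n ltnS => /card_gt0P[j].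
  by rewrite !inE => /and3P[ji hj uj]; exists j; rewrite // hj.
have third l : h \in E l -> u \in E l -> (l == i) || (l == j).
  move=> hl ul; apply: contraT; rewrite negb_or => /andP[li lj].
  have := face_codeg_le2 fo neq_hu; rewrite leqNgt => /negP[].
  rewrite /face_codeg (cardsD1 i) (cardsD1 j) (cardsD1 l) !inE hi ui hj uj hl ul li lj ji.
  by rewrite !addnA leq_addr.
have [l [p [pl abl [li pE]]]] : exists l p : 'I_f,
    [/\ p < l, [set a l; b l] = [set h; u] & rev (c l) \in face (c p) /\ ((l == i) || (p == i))].
  have step (l m : 'I_f) : m < l -> h \in E l -> u \in E l -> h \in E m -> u \in E m ->
      (l == i) && (m == j) || (l == j) && (m == i) ->
      exists l p : 'I_f, [/\ p < l, [set a l; b l] = [set h; u] &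
        rev (c l) \in face (c p) /\ ((l == i) || (p == i))].
    move=> ml hl ul hm um lm; have [p pl pE] := par l (leq_ltn_trans (leq0n _) ml).
    have ablE := old_pair fo neq_hu ml ml hl ul hm um.
    exists l, p; split=> //; split=> //.
    have ap : a l \in E p := head_in _ _ pE.
    have bp : b l \in E p := tail_in _ _ pE.
    have sub_p z : z \in [set h; u] -> z \in E p by rewrite -ablE => /set2P[]->.
    have := third p (sub_p h (set21 _ _)) (sub_p u (set22 _ _)).
    have : p != l by rewrite -val_eqE /= ltn_eqF.
    case/orP: lm => /andP[/eqP lE _]; first by rewrite lE eqxx.
    by rewrite lE => /negPf->; rewrite orbF => ->; rewrite orbT.
  have [ij|lt_ji|/val_inj eq_ij] := ltngtP i j.
  - by apply: (step j i); rewrite ?eqxx ?orbT.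
  - by apply: (step i j); rewrite ?eqxx ?orbT.
  - by rewrite eq_ij eqxx in ji.
have [e ei eE] : exists2 e, e \in face (c i) & [set tail e; head e] = [set h; u].
  case/orP: pE => /eqP <-; first by exists (c l); rewrite ?porbit_id.
  by exists (rev (c l)); rewrite // tail_rev head_rev setUC.
have u_in : u \in [set tail e; head e] by rewrite eE set22.
have h_in : h \in [set tail e; head e] by rewrite eE set21.
have e1E e' : e' \in face (c i) -> tail e' = h -> e' = e1.
  by move=> e'i e'h; apply: (interior_inj kang (cO i)) => //; rewrite e'h hE.
case/set2P: h_in => h_e.
  have eE1 : e = e1 by apply: e1E.
  case/set2P: u_in => u_e; last by rewrite u_e eE1 set21.
  by rewrite u_e -h_e eqxx in neq_uh.
have phi_e : phi e = e1.
  by apply: e1E; rewrite ?tail_face_perm // face_mem_perm.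
rewrite !inE /e2 -phi_e permK; case/set2P: u_in => u_e; first by rewrite u_e eqxx orbT.
by rewrite u_e -h_e eqxx in neq_uh.
Qed.

End KAngulationOrder.

(** * Uniqueness of the fan *)

(* Model of the fan with [f] faces of [q + 2] vertices: [None] is the hub,    *)
(* [Some None] its first neighbour, and [Some (Some (i, r))] the vertices of  *)
(* face [i] that are new in the order of the faces around the hub, [r = 0]    *)
(* being the neighbour of the hub shared with face [i + 1].                   *)
Section FanModel.
Variables (q f : nat).

Definition fan_vert : finType := option (option ('I_f * 'I_q)).

Definition fan_face (i : 'I_f) : {set fan_vert} :=
  [set x : fan_vert | match (x : option (option ('I_f * 'I_q))) with
           | None => true
           | Some None => i == 0 :> nat
           | Some (Some (j, r)) => (j == i) || (j.+1 == i :> nat) && (r == 0 :> nat)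
           end].

Definition fan_hypergraph : {set {set fan_vert}} := [set fan_face i | i : 'I_f].

Lemma card_fan_vert : #|fan_vert| = q * f + 2.
Proof. by rewrite !card_option card_prod !card_ord mulnC addn2. Qed.

End FanModel.

Section Fan.
Variables (V : finType) (G : plane_graph V) (k : nat).
Hypothesis k_gt2 : 2 < k.
Hypothesis kang : kangulation G k.
Variable h : V.
Hypothesis hub : forall F, F \in interior_faces G -> h \in face_verts F.
Notation rot := (pg_rot G).
Notation phi := (face_perm rot).
Notation O := (pg_outer G).
Notation tail := (@dtail V G).
Notation head := (@dhead V G).
Notation rev := (@drev V G).
Notation face := (porbit phi).
Notation f := #|interior_faces G|.
Variable o : dart G.
Hypothesis oO : o \in O.
Hypothesis tail_o : tail o = h.

(** The darts at the hub in rotation order from the outer one; [c 1], ..., [c f] represent the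
    interior faces. *)
Let c i := (rot ^+ i)%g o.

Let tail_c i : tail (c i) = h.
Proof. by rewrite -tail_o; apply/eqP; rewrite -pg_rotP mem_porbit. Qed.

Let cS i : c i.+1 = rot (c i).
Proof. by rewrite /c expgSr permM. Qed.

Let hub_darts d : (d \in porbit rot o) = (tail d == h).
Proof. by rewrite pg_rotP tail_o. Qed.

Let outer_hub d : tail d = h -> (d \in O) = (d == o).
Proof.
move=> dh; apply/idP/eqP => [dO|-> //].
by apply: (outer_inj kang) => //; rewrite dh tail_o.
Qed.

Lemma fan_hub_deg : #|porbit rot o| = f.+1.
Proof.
rewrite (cardsD1 o) porbit_id add1n; congr _.+1.
rewrite -(card_in_imset (f := face)); last first.
  move=> d e; rewrite !inE !hub_darts => /andP[d_o /eqP dh] /andP[e_o /eqP eh] eq_f.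
  apply: (interior_inj kang (d := e)); rewrite ?porbit_id ?dh ?eh //.
    by rewrite outer_hub.
  by rewrite -eq_f porbit_id.
apply: eq_card => F; apply/imsetP/idP => [[d]|F_int].
  rewrite in_setD1 hub_darts => /andP[d_o /eqP dh] ->.
  by apply: face_interior; rewrite outer_hub.
have /imsetP[d dF hd] := hub F_int.
have [e eO FE] := interior_faceE F_int; rewrite FE in dF.
exists d; last by rewrite FE; apply/eqP; rewrite eq_porbit_mem porbit_sym.
rewrite in_setD1 hub_darts -hd eqxx andbT -(outer_hub (esym hd)).
exact: notin_outer_face eO dF.
Qed.

Let c_outer i : 0 < i <= f -> c i \notin O.
Proof.
case/andP=> i_gt0 i_le; rewrite outer_hub //; apply/eqP => cE.
have := uniq_traject_porbit rot o; rewrite fan_hub_deg => /(nth_uniq o).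
rewrite size_traject => /(_ i 0); rewrite ltnS i_le !nth_traject ?ltnS //.
move/(_ isT isT); rewrite -permX -/(c i) cE eqxx => /esym/eqP iE.
by rewrite iE in i_gt0.
Qed.

Let face_c F : F \in interior_faces G -> exists i : 'I_f, F = face (c i.+1).
Proof.
move=> F_int; have /imsetP[d dF hd] := hub F_int.
have [e eO FE] := interior_faceE F_int; rewrite FE in dF.
have : d \in porbit rot o by rewrite hub_darts hd.
rewrite porbit_traject fan_hub_deg => /trajectP[i]; rewrite ltnS -permX => i_le dE.
have := notin_outer_face eO dF; rewrite outer_hub // dE => d_o.
case: i i_le dE d_o => [|i] i_le dE d_o; first by rewrite expg0 perm1 eqxx in d_o.
exists (Ordinal i_le).
by rewrite FE /c /= -dE; apply/eqP; rewrite eq_porbit_mem porbit_sym.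
Qed.

Let card_c (i : 'I_f) : #|face (c i.+1)| = k.
Proof. by apply: (card_interior kang); apply: c_outer; apply: ltn_ord. Qed.

Let last_c i : c i.+1 = phi (rev (c i)).
Proof. by rewrite face_perm_rev cS. Qed.

(** The walk around face [i] leaves the hub along [c i.+1] and returns along the reverse of [c i],
    so consecutive faces share [head (c i)]. *)
Let iter_last (i : 'I_f) : (phi ^+ k.-1)%g (c i.+1) = rev (c i).
Proof.
apply: (@perm_inj _ phi); rewrite -last_c -permM -expgSr prednK ?(ltn_trans _ k_gt2) //.
by rewrite permX -(card_c i) iter_porbit.
Qed.

Definition fan_map (x : fan_vert (k - 2) f) : V :=
  match x with
  | None => h
  | Some None => head o
  | Some (Some (i, r)) => tail ((phi ^+ r.+1)%g (c i.+1))
  end.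

Let fan_map_first (i : 'I_f) (r : 'I_(k - 2)) : r = 0 :> nat ->
  fan_map (Some (Some (i, r))) = head (c i.+1).
Proof. by rewrite /fan_map => ->; rewrite expg1 tail_face_perm. Qed.

Let k2_gt0 : 0 < k - 2. Proof. by rewrite subn_gt0. Qed.

Let fan_map_shared (i : 'I_f) :
  exists2 x, x \in fan_face (k - 2) i & fan_map x = head (c i).
Proof.
case: i => [[|i] i_lt] /=; first by exists (Some None); rewrite ?inE // /c expg0 perm1.
have i_lt' : i < f := ltn_trans (ltnSn i) i_lt.
exists (Some (Some (Ordinal i_lt', Ordinal k2_gt0))); first by rewrite inE /= eqxx orbT.
exact: fan_map_first.
Qed.

Lemma fan_map_face i : fan_map @: fan_face (k - 2) i = face_verts (face (c i.+1)).
Proof.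
apply/setP => v; apply/imsetP/imsetP => [[x x_i ->]|[d d_i ->]].
  have in_face (j : 'I_f) r : (phi ^+ r)%g (c j.+1) \in face (c j.+1) by apply: mem_porbit.
  have shared (m : nat) : m = i -> exists2 d, d \in face (c i.+1) & head (c m) = tail d.
    move=> ->; exists ((phi ^+ k.-1)%g (c i.+1)) => //.
    by rewrite iter_last.
  case: x x_i => [[[j r]|]|]; rewrite inE.
  - case/orP => [/eqP ->|/andP[/eqP jE /eqP r0]]; first by exists ((phi ^+ r.+1)%g (c i.+1)).
    by rewrite fan_map_first //; apply: shared.
  - by move/eqP => i0; have := shared 0 (esym i0); rewrite /c expg0 perm1.
  - by exists (c i.+1); rewrite ?porbit_id.
move: d_i; rewrite porbit_traject card_c => /trajectP[r r_lt ->]; rewrite -permX.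
case: r r_lt => [|r] r_lt; first by exists None; rewrite ?inE // expg0 perm1 tail_c.
have [r_lt2|] := ltnP r (k - 2).
  by exists (Some (Some (i, Ordinal r_lt2))); rewrite ?inE ?eqxx.
move=> r_ge; have -> : r.+1 = k.-1 by move: r_lt r_ge k_gt2; clear; lia.
rewrite iter_last tail_rev; have [x x_i xE] := fan_map_shared i.
by exists x.
Qed.

(** Every vertex lies on an interior face, so the map is onto, and [card_verts] makes the two sizes
    equal. *)
Lemma fan_map_bij : bijective fan_map.
Proof.
have onto : fan_map @: setT = setT.
  apply/setP => v; rewrite [RHS]inE; apply/imsetP.
  have [e eO <-] := outer_at kang v.
  have [i FE] := face_c (face_interior (rev_notin_outer kang eO)).
  have : tail e \in face_verts (face (c i.+1)).
    rewrite -FE -head_rev -tail_face_perm; apply: imset_f.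
    by rewrite face_mem_perm porbit_id.
  by rewrite -fan_map_face => /imsetP[x _ ->]; exists x.
have card_eq : #|fan_vert (k - 2) f| = #|V| by rewrite card_fan_vert (card_verts k_gt2 kang).
apply: inj_card_bij; last by rewrite card_eq.
have /imset_injP inj : #|fan_map @: setT| == #|[set: fan_vert (k - 2) f]|.
  by rewrite onto !cardsT card_eq.
by move=> x y; apply: inj.
Qed.

Lemma fan_hypergraph_iso_of_hub : hypergraph_iso (fan_hypergraph (k - 2) f) (face_hypergraph G).
Proof.
exists fan_map => [|e]; first exact: fan_map_bij.
apply/imsetP/imsetP => [[F F_int eF]|[i _ ->]]; last first.
  exists (face (c i.+1)); first by apply: face_interior; apply: c_outer; apply: ltn_ord.
  exact: fan_map_face.
have [i FE] := face_c F_int; exists i => //.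
by apply: (imset_inj (bij_inj fan_map_bij)); rewrite eF FE fan_map_face.
Qed.

End Fan.

Lemma fan_hypergraph_iso (V : finType) (G : plane_graph V) (k f : nat) :
  2 < k -> fan_kangulation G k f ->
  hypergraph_iso (fan_hypergraph (k - 2) f) (face_hypergraph G).
Proof.
move=> k_gt2 [kang <- [h hub]]; have [o oO oh] := outer_at kang h.
exact: fan_hypergraph_iso_of_hub oO oh.
Qed.

(** * Existence of the fan *)

(* The fan is drawn as a path [0, 1, ..., q * f] whose vertices divisible by  *)
(* [q] are joined to the hub [q * f + 1]. A dart belongs to exactly one face, *)
(* whose label is 0 for the outer face and [l] for the face that contains the *)
(* path from [q * (l - 1)] to [q * l].                                        *)
Section FanGraph.
Variables (q f : nat).
Hypothesis q_gt0 : 0 < q.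
Hypothesis f_gt0 : 0 < f.

Let M := q * f.
Let hub := M.+1.

Definition fan_edge (x y : nat) : bool :=
  [|| (x.+1 == y) && (y <= M), (y.+1 == x) && (x <= M),
      [&& x == hub, y <= M & q %| y] | [&& y == hub, x <= M & q %| x]].

Definition fan_label (x y : nat) : nat :=
  if x == hub then y %/ q
  else if y == hub then if x == M then 0 else (x %/ q).+1
  else if x < y then 0 else (y %/ q).+1.

(** The successor of [x] on face [l]. The outer walk is hub, 0, 1, ..., [M]; face [l > 0] goes from
    the hub to [q * l] and down the path to [q * l.-1]. *)
Definition fan_out (l x : nat) : nat :=
  if l == 0 then if x == hub then 0 else x.+1
  else if x == hub then q * l else if x == q * l.-1 then hub else x.-1.

Definition on_face (l x : nat) : bool :=
  [|| l == 0, x == hub | q * l.-1 <= x <= q * l].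

Let M_gt0 : 0 < M. Proof. by rewrite muln_gt0 q_gt0. Qed.

Let div_bounds x : q * (x %/ q) <= x < q * (x %/ q).+1.
Proof. by rewrite mulnC leq_trunc_div /= mulnC ltn_ceil. Qed.

Let div_lt x : x < M -> x %/ q < f.
Proof. by move=> xM; rewrite ltn_divLR // mulnC. Qed.

Let mul_le l : l <= f -> q * l <= M.
Proof. by move=> lf; rewrite leq_mul2l lf orbT. Qed.

Lemma fan_edgeP x y : fan_edge x y ->
  [/\ fan_label x y <= f, on_face (fan_label x y) x, on_face (fan_label x y) y
    & y = fan_out (fan_label x y) x].
Proof.
rewrite /fan_edge /fan_label /on_face /fan_out.
case/or4P => [/andP[/eqP <- xM]|/andP[/eqP <- yM]|/and3P[/eqP -> yM qy]|/and3P[/eqP -> xM qx]].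
- rewrite (ltn_eqF (_ : x < hub)) ?(ltn_eqF (_ : x.+1 < hub)) ?ltnS ?leqnn // ltnW //.
- have := div_bounds y; have := div_lt yM.
  have -> : (y.+1 == hub) = false by rewrite ltn_eqF.
  have -> : (y == hub) = false by rewrite ltn_eqF // ltnW.
  have -> : (y.+1 < y) = false by rewrite ltnNge leqnSn.
  rewrite /= => lt_f /andP[le_y lt_y]; rewrite le_y lt_y (leq_trans le_y) ?leqnSn //=.
  by rewrite (ltnW lt_y) ?orbT; split=> //; case: eqP => // yE; rewrite -yE ltnn in le_y.
- rewrite !eqxx /= orbT; have yE := divnK qy; rewrite mulnC in yE.
  have yf : y %/ q <= f by rewrite leq_divLR // mulnC.
  case: (posnP (y %/ q)) => [y0|y_gt0]; first by split=> //; rewrite -yE y0 muln0.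
  have le_y : q * (y %/ q).-1 <= y by rewrite -[leqRHS]yE leq_mul2l leq_pred orbT.
  by split; rewrite ?yE ?leqnn ?le_y ?orbT.
- have -> : (x == hub) = false by rewrite ltn_eqF // ltnS.
  rewrite eqxx; have xE := divnK qx; rewrite mulnC in xE.
  case: (eqVneq x M) => [->|neq_xM] //=.
  have xf : x %/ q < f by rewrite div_lt // ltn_neqAle neq_xM.
  rewrite xE !eqxx leqnn /= ?orbT; split=> //.
  by rewrite mulnS xE leq_addl.
Qed.

Lemma fan_outP l x : l <= f -> x <= hub -> on_face l x ->
  fan_edge x (fan_out l x) /\ fan_label x (fan_out l x) = l.
Proof.
rewrite /fan_edge /fan_label /on_face /fan_out; case: l => [|l] lf x_hub /=.
  move=> _; case: (eqVneq x hub) => [->|neq_x]; first by rewrite leq0n dvdn0 !orbT div0n.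
  have xM : x <= M by rewrite -ltnS ltn_neqAle neq_x.
  case: (eqVneq x M) => [->|neq_xM]; last first.
    have x_lt : x < M by rewrite ltn_neqAle neq_xM.
    by rewrite eqxx x_lt (ltn_eqF (_ : x.+1 < hub)) ?ltnS // leqnn.
  by rewrite eqxx dvdn_mulr // leqnn !orbT.
have le_M := mul_le lf; have lt_M : q * l < M by apply: leq_trans le_M; rewrite ltn_pmul2l.
case: (eqVneq x hub) => [->|neq_x] /=.
  by rewrite le_M dvdn_mulr // !orbT mulKn.
case/andP=> x_ge x_le; have xM : x <= M by apply: leq_trans le_M.
case: (eqVneq x (q * l)) => [xE|neq_xl].
  by rewrite eqxx xE dvdn_mulr // (ltnW lt_M) !orbT (ltn_eqF lt_M) mulKn.
have x_gt : q * l < x by rewrite ltn_neqAle eq_sym neq_xl.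
have x_gt0 : 0 < x by apply: leq_ltn_trans x_gt.
rewrite prednK // eqxx xM !orbT; split=> //.
rewrite (ltn_eqF (_ : x.-1 < hub)); last by rewrite prednK // ltnW // ltnS.
rewrite ltnNge leq_pred /=; congr _.+1.
by apply/eqP; rewrite eqn_leq -ltnS ltn_divLR // leq_divRL // ![_ * q]mulnC prednK // x_le -ltnS prednK.
Qed.

Lemma fan_out_inj l x y : l <= f -> x <= hub -> y <= hub -> on_face l x -> on_face l y ->
  fan_out l x = fan_out l y -> x = y.
Proof.
rewrite /on_face /fan_out; case: l => [|l] lf x_hub y_hub /=.
  by move=> _ _; case: (eqVneq x hub) => [->|_]; case: (eqVneq y hub) => [->|_] // [].
have le_M := mul_le lf; have lt_M : q * l < q * l.+1 by rewrite ltn_pmul2l.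
move: lt_M le_M; set A := q * l; set B := q * l.+1; move: A B x_hub y_hub; rewrite /hub.
move: M; clear => M' A B x_hub y_hub AB BM.
by case: (eqVneq x M'.+1) => ?; case: (eqVneq y M'.+1) => ?;
  case: (eqVneq x A) => ?; case: (eqVneq y A) => ?; lia.
Qed.

Definition fan_adj : rel 'I_M.+2 := fun x y => fan_edge x y.

Lemma fan_adj_sym : symmetric fan_adj.
Proof. by move=> x y; rewrite /fan_adj /fan_edge orbCA; congr [|| _, _ | _]; rewrite orbC. Qed.

Lemma fan_adj_irr : irreflexive fan_adj.
Proof.
move=> x; rewrite /fan_adj /fan_edge gtn_eqF //= orbb.
by apply/and3P => -[/eqP -> ]; rewrite ltnn.
Qed.

Definition fan_graph : sgraph 'I_M.+2 := SGraph fan_adj_sym fan_adj_irr.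

Notation dartF := (dart fan_graph).
Notation tail := (@dtail _ fan_graph).
Notation head := (@dhead _ fan_graph).
Notation rev := (@drev _ fan_graph).

Let dlabel (d : dartF) : nat := fan_label (tail d) (head d).

Let dart_edge (d : dartF) : fan_edge (tail d) (head d).
Proof. exact: valP d. Qed.

Let ord_hub (x : 'I_M.+2) : x <= hub. Proof. by rewrite -ltnS ltn_ord. Qed.

Lemma dlabel_inj (d e : dartF) : dlabel d = dlabel e -> tail d = tail e -> d = e.
Proof.
move=> eq_l eq_t; apply: dart_eq => //; apply/val_inj => /=.
have [_ _ _ ->] := fan_edgeP (dart_edge d); have [_ _ _ ->] := fan_edgeP (dart_edge e).
by rewrite -/(dlabel d) -/(dlabel e) eq_l eq_t.
Qed.

Lemma exists_fan_dart l (x : 'I_M.+2) : l <= f -> on_face l x ->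
  exists d : dartF, [/\ tail d = x, head d = fan_out l x :> nat & dlabel d = l].
Proof.
move=> lf lx; have [edge lab] := fan_outP lf (ord_hub x) lx.
have out_lt : fan_out l x < M.+2.
  rewrite ltnS; case/or4P: (edge) => [/andP[_ yM]|/andP[/eqP yE xM]|/and3P[_ yM _]|/and3P[/eqP -> _ _]] //.
  - exact: leqW.
  - by rewrite leqW // -ltnS yE leqW.
  - exact: leqW.
have adj_out : fan_adj (x, Ordinal out_lt).1 (x, Ordinal out_lt).2 by [].
by exists (exist _ (x, Ordinal out_lt) adj_out).
Qed.

Let dart_label_le (d : dartF) : dlabel d <= f.
Proof. by have [] := fan_edgeP (dart_edge d). Qed.

Let dart_on_tail (d : dartF) : on_face (dlabel d) (tail d).
Proof. by have [] := fan_edgeP (dart_edge d). Qed.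

Let dart_on_head (d : dartF) : on_face (dlabel d) (head d).
Proof. by have [] := fan_edgeP (dart_edge d). Qed.

Let dart_head (d : dartF) : head d = fan_out (dlabel d) (tail d) :> nat.
Proof. by have [] := fan_edgeP (dart_edge d). Qed.

Lemma exists_next_dart (d : dartF) :
  exists e : dartF, (tail e == tail d) && (dlabel e == dlabel (rev d)).
Proof.
have [e [eT _ eL]] := exists_fan_dart (dart_label_le (rev d)) (dart_on_head (rev d)).
by exists e; rewrite eT eL !eqxx.
Qed.

(** Facial walks must preserve labels, which forces the rotation: [d] is followed by the dart at its
    tail carrying the label of its reverse. *)
Definition next_dart (d : dartF) : dartF := xchoose (exists_next_dart d).

Lemma tail_next_dart d : tail (next_dart d) = tail d.
Proof. by have /andP[/eqP] := xchooseP (exists_next_dart d). Qed.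

Lemma dlabel_next_dart d : dlabel (next_dart d) = dlabel (rev d).
Proof. by have /andP[_ /eqP] := xchooseP (exists_next_dart d). Qed.

Lemma next_dart_inj : injective next_dart.
Proof.
move=> d e eq_de.
have eq_t : tail d = tail e by rewrite -tail_next_dart eq_de tail_next_dart.
have eq_l : dlabel (rev d) = dlabel (rev e) by rewrite -!dlabel_next_dart eq_de.
apply: dart_eq => //; apply/val_inj => /=.
apply: (@fan_out_inj (dlabel (rev d))); rewrite ?ord_hub ?dart_label_le ?(dart_on_tail (rev d)) //.
  by rewrite eq_l (dart_on_tail (rev e)).
have := dart_head (rev d); have := dart_head (rev e).
by rewrite -eq_l => <- <-; rewrite /= -[LHS]/(tail d : nat) eq_t.
Qed.

Definition fan_rot : {perm dartF} := perm next_dart_inj.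
Notation phi := (face_perm fan_rot).

Lemma fan_rotE d : fan_rot d = next_dart d. Proof. exact: permE. Qed.

Lemma fan_phi_tail d : tail (phi d) = head d.
Proof. by rewrite /face_perm permM !permE tail_next_dart. Qed.

Lemma fan_phi_label d : dlabel (phi d) = dlabel d.
Proof. by rewrite /face_perm permM !permE dlabel_next_dart drevK. Qed.

Lemma fan_rot_eq (d e : dartF) :
  tail e = tail d -> dlabel e = dlabel (rev d) -> e = fan_rot d.
Proof.
move=> eT eL; rewrite fan_rotE; apply: dlabel_inj.
  by rewrite dlabel_next_dart.
by rewrite tail_next_dart.
Qed.

Let porbit_step (s : {perm dartF}) (d e : dartF) : d \in porbit s e -> s d \in porbit s e.
Proof. by rewrite porbit_sym => ed; rewrite porbit_sym -[s d]/((s ^+ 1)%g d) porbit_perm. Qed.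

(** Around the hub, each turn raises the label by one. *)
Lemma hub_rot_orbit (d e : dartF) : tail d = hub :> nat -> tail e = hub :> nat ->
  dlabel d = 0 -> e \in porbit fan_rot d.
Proof.
move=> dT + dL; move: {2}(dlabel e) (erefl (dlabel e)) => l.
elim: l e => [|l IHl] e eL eT.
  suff -> : e = d by apply: porbit_id.
  by apply: dlabel_inj; rewrite ?eL //; apply/val_inj; rewrite /= dT eT.
have lf : l < f by rewrite -eL dart_label_le.
have on_hub : on_face l (tail d) by rewrite /on_face dT eqxx orbT.
have [e' [e'T e'H e'L]] := exists_fan_dart (ltnW lf) on_hub.
have -> : e = fan_rot e'.
  apply: fan_rot_eq; first by apply/val_inj; rewrite /= eT e'T dT.
  have e'hub : tail e' = hub :> nat by rewrite e'T dT.
  have e'E : head e' = q * l :> nat.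
    rewrite e'H /fan_out dT eqxx; case: eqP => // ->; exact/esym/muln0.
  have lM : q * l < M by rewrite ltn_pmul2l.
  rewrite eL /dlabel /fan_label /= -/(dhead e') -/(dtail e') e'E e'hub eqxx.
  by rewrite (ltn_eqF (_ : q * l < hub)) ?(ltn_eqF lM) ?mulKn // ltnS ltnW.
by apply: porbit_step; apply: IHl => //; rewrite e'T.
Qed.

(** Around a path vertex the rotation leads from the backward dart to the outer dart [d], then to
    the hub dart if there is a further one; at [M] the outer dart itself goes to the hub. *)
Lemma path_rot_orbit (d e : dartF) : tail d <= M -> tail e = tail d ->
  dlabel d = 0 -> e \in porbit fan_rot d.
Proof.
move=> dM eT dL; have d_hub : (tail d == hub :> nat) = false by rewrite ltn_eqF.
have dH : head d = (tail d).+1 :> nat by rewrite dart_head dL /fan_out d_hub.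
have zero_d (e' : dartF) : tail e' = tail d -> dlabel e' = 0 -> e' = d.
  by move=> e'T e'L; apply: dlabel_inj; rewrite ?e'L.
case/or4P: (dart_edge e); rewrite eT.
- case/andP=> /eqP eH yM; rewrite (zero_d e) ?porbit_id // /dlabel /fan_label eT d_hub -eH.
  by rewrite ltnSn ltn_eqF // eH.
- case/andP=> /eqP eH _.
  have -> : d = fan_rot e; last by rewrite porbit_sym porbit_step ?porbit_id.
  apply: fan_rot_eq; first by rewrite eT.
  rewrite dL /dlabel /fan_label -[dtail (rev e)]/(dhead e) -[dhead (rev e)]/(dtail e) eT d_hub.
  have lt_e : head e < tail d by rewrite -eH.
  by rewrite lt_e ltn_eqF // (ltn_trans lt_e).
- by case/and3P=> /eqP dE; rewrite dE ltnn in dM.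
- case/and3P=> /eqP eH _ q_e.
  case: (eqVneq (tail d : nat) M) => [dM'|neq_dM].
    rewrite (zero_d e) ?porbit_id // /dlabel /fan_label eT d_hub eH eqxx.
    by rewrite dM' eqxx.
  have -> : e = fan_rot d; last by rewrite porbit_step ?porbit_id.
  apply: fan_rot_eq => //.
  rewrite /dlabel /fan_label -[dtail (rev d)]/(dhead d) -[dhead (rev d)]/(dtail d) eT d_hub eH eqxx.
  rewrite (negPf neq_dM) dH ltnNge leqnSn /= ltn_eqF // ltnS.
  by rewrite ltn_neqAle neq_dM.
Qed.

Lemma fan_rotP (d d' : dartF) : (d' \in porbit fan_rot d) = (tail d' == tail d).
Proof.
apply/idP/eqP => [/porbitP[i ->]|eT].
  elim: i => [|i IHi]; first by rewrite expg0 perm1.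
  by rewrite expgSr permM fan_rotE tail_next_dart.
have [e [e_T _ eL]] := exists_fan_dart (leq0n f) (isT : on_face 0 (tail d)).
suff all_e (x : dartF) : tail x = tail d -> x \in porbit fan_rot e.
  have := all_e d erefl; have := all_e d' eT; rewrite porbit_sym => d'e de.
  by move: de; rewrite -!eq_porbit_mem in d'e * => /eqP ->; rewrite eq_sym.
move=> xT; have := ord_hub (tail d); rewrite leq_eqVlt => /predU1P[d_hub|].
  by apply: hub_rot_orbit; rewrite ?e_T ?xT ?d_hub.
by rewrite ltnS => dM; apply: path_rot_orbit; rewrite ?e_T.
Qed.

Let hub_ord : 'I_M.+2 := ord_max.

Lemma exists_base (l : 'I_f.+1) :
  exists d : dartF, (tail d == hub_ord) && (dlabel d == l).
Proof.
have on_hub : on_face l hub_ord by rewrite /on_face eqxx orbT.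
have [d [dT _ dL]] := exists_fan_dart (leq_ord l) on_hub.
by exists d; rewrite dT dL !eqxx.
Qed.

Definition face_base (l : 'I_f.+1) : dartF := xchoose (exists_base l).

Let base_tail l : tail (face_base l) = hub_ord.
Proof. by have /andP[/eqP] := xchooseP (exists_base l). Qed.

Let base_label l : dlabel (face_base l) = l.
Proof. by have /andP[_ /eqP] := xchooseP (exists_base l). Qed.

(** Labels are invariant along the walk. Conversely, starting at the hub and following [fan_out]
    reaches every dart labelled [l]: upward along the path for the outer face, downward from [q * l]
    for the others. *)
Lemma mem_face_base (l : 'I_f.+1) (d : dartF) :
  (d \in porbit phi (face_base l)) = (dlabel d == l).
Proof.
apply/idP/eqP => [/porbitP[i ->]|dL].
  elim: i => [|i IHi]; first by rewrite expg0 perm1.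
  by rewrite expgSr permM fan_phi_label.
have step (x : 'I_M.+2) : on_face l x ->
    (forall e : dartF, dlabel e = l -> tail e = x -> e \in porbit phi (face_base l)) ->
    forall e : dartF, dlabel e = l -> tail e = fan_out l x :> nat ->
      e \in porbit phi (face_base l).
  move=> lx IH e eL eT; have [e' [e'T e'H e'L]] := exists_fan_dart (leq_ord l) lx.
  have -> : e = phi e'; last by apply: porbit_step; apply: IH.
  apply: dlabel_inj; rewrite ?fan_phi_label ?eL //.
  by apply/val_inj; rewrite fan_phi_tail /= eT e'H.
have at_hub (e : dartF) : dlabel e = l -> tail e = hub_ord -> e \in porbit phi (face_base l).
  move=> eL eT; suff -> : e = face_base l by apply: porbit_id.
  by apply: dlabel_inj; rewrite ?base_label ?base_tail.
have on_hub : on_face l hub_ord by rewrite /on_face eqxx orbT.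
have [dT|neq_d] := eqVneq (tail d) hub_ord; first exact: at_hub.
have {neq_d}dM : tail d <= M.
  by rewrite -ltnS ltn_neqAle ord_hub andbT; apply: contra neq_d => /eqP dE; apply/eqP/val_inj.
have path_step n x (e : dartF) : x <= M -> on_face l x -> fan_out l x = n ->
    (forall e : dartF, dlabel e = l -> tail e = x :> nat -> e \in porbit phi (face_base l)) ->
    dlabel e = l -> tail e = n :> nat -> e \in porbit phi (face_base l).
  move=> xM lx xE IH eL eT.
  have x_lt : x < M.+2 by rewrite ltnS leqW.
  apply: (step (Ordinal x_lt)) => //=; last by rewrite xE.
  by move=> e' e'L e'T; apply: IH => //; rewrite e'T.
have := dart_on_tail d; rewrite /on_face dL (ltn_eqF (_ : tail d < hub)) //=.
case: (posnP l) => [l0 _|l_gt0 /=].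
  suff all n (e : dartF) : n <= M -> dlabel e = l -> tail e = n :> nat ->
      e \in porbit phi (face_base l) by apply: all dM dL erefl.
  elim: n e => [|n IHn] e n_le eL eT.
    by apply: (step _ on_hub at_hub e eL); rewrite eT /fan_out l0 /= eqxx.
  apply: (path_step n.+1 n) => //; first exact: ltnW.
  - by rewrite /on_face l0.
  - by rewrite /fan_out l0 (ltn_eqF (_ : n < hub)) // ltnS ltnW.
  - by move=> e' e'L e'T; apply: IHn => //; apply: ltnW.
case/andP=> d_ge d_le.
have lM : q * l <= M := mul_le (leq_ord l).
have lE : q * l = q * l.-1 + q by rewrite -mulnSr prednK.
suff all t (e : dartF) : t <= q -> dlabel e = l -> tail e = q * l - t :> nat ->
    e \in porbit phi (face_base l).
  apply: (all (q * l - tail d)) => //; last by rewrite subKn.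
  by rewrite leq_subLR addnC -leq_subLR lE addnK.
elim: t e => [|t IHt] e t_le eL eT.
  apply: (step _ on_hub at_hub e eL).
  by rewrite eT subn0 /fan_out /= eqxx gtn_eqF.
have x_gt : q * l.-1 < q * l - t by rewrite ltn_subRL lE addnC ltn_add2l.
have x_le : q * l - t <= M by apply: leq_trans (leq_subr _ _) lM.
apply: (path_step _ (q * l - t) e _ _ _ _ eL eT) => //.
- by rewrite /on_face leq_subr (ltnW x_gt) !orbT.
- rewrite /fan_out gtn_eqF // (ltn_eqF (_ : _ < hub)) // (gtn_eqF x_gt).
  by rewrite subnS.
- by move=> e' e'L e'T; apply: IHt => //; apply: ltnW.
Qed.

Lemma fan_face_sets : face_sets fan_rot = [set porbit phi (face_base l) | l : 'I_f.+1].
Proof.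
apply/setP => F; apply/imsetP/imsetP => [[d _ ->]|[l _ ->]]; last by exists (face_base l).
have l_lt : dlabel d < f.+1 by rewrite ltnS dart_label_le.
exists (Ordinal l_lt) => //; apply/eqP.
by rewrite eq_porbit_mem mem_face_base.
Qed.

Lemma face_base_inj : injective (fun l => porbit phi (face_base l)).
Proof.
move=> l l' eq_l; apply/val_inj/eqP; rewrite /= -(base_label l) -mem_face_base.
by rewrite -eq_l porbit_id.
Qed.

Lemma card_fan_face_sets : #|face_sets fan_rot| = f.+1.
Proof. by rewrite fan_face_sets card_imset ?card_ord //; apply: face_base_inj. Qed.

Lemma face_base_tail_inj l : {in porbit phi (face_base l) &, injective tail}.
Proof.
by move=> d e; rewrite !mem_face_base => /eqP dL /eqP eL; apply: dlabel_inj; rewrite dL.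
Qed.

Lemma face_base_tails (l : 'I_f.+1) :
  [set tail d | d in porbit phi (face_base l)] = [set x : 'I_M.+2 | on_face l x].
Proof.
apply/setP => x; rewrite inE; apply/imsetP/idP => [[d]|lx].
  by rewrite mem_face_base => /eqP <- ->.
have [d [dT _ dL]] := exists_fan_dart (leq_ord l) lx.
by exists d; rewrite ?mem_face_base ?dL.
Qed.

Lemma card_on_face l : 0 < l <= f -> #|[set x : 'I_M.+2 | on_face l x]| = q.+2.
Proof.
case/andP=> l_gt0 lf; have lE : q * l = q * l.-1 + q by rewrite -mulnSr prednK.
have lM := mul_le lf.
pose g (r : 'I_q.+2) : 'I_M.+2 := if r == q.+1 :> nat then hub_ord else inord (q * l.-1 + r).
have g_lt (r : 'I_q.+2) : r != q.+1 :> nat -> q * l.-1 + r <= q * l.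
  by move=> r_neq; rewrite lE leq_add2l -ltnS ltn_neqAle r_neq -ltnS ltn_ord.
have g_val (r : 'I_q.+2) : r != q.+1 :> nat -> g r = q * l.-1 + r :> nat.
  move=> r_neq; rewrite /g (negPf r_neq) inordK // ltnS leqW //.
  exact: leq_trans (g_lt r r_neq) lM.
have g_hub (r : 'I_q.+2) : r != q.+1 :> nat -> g r < hub.
  by move=> r_neq; rewrite g_val // ltnS (leq_trans (g_lt r r_neq)).
rewrite -[RHS]card_ord -(card_imset (f := g)); last first.
  move=> r r' eq_g; apply/val_inj => /=.
  case: (eqVneq (r : nat) q.+1) => [rE|r_neq]; case: (eqVneq (r' : nat) q.+1) => [r'E|r'_neq].
  - by rewrite rE r'E.
  - by have := g_hub r' r'_neq; rewrite -eq_g /g rE eqxx ltnn.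
  - by have := g_hub r r_neq; rewrite eq_g /g r'E eqxx ltnn.
  - by apply: (@addnI (q * l.-1)); rewrite -!g_val // eq_g.
apply: eq_card => x; rewrite inE /on_face gtn_eqF //=.
apply/orP/imsetP => [[/eqP xE|/andP[x_ge x_le]]|[r _ ->]].
- by exists ord_max => //; apply/val_inj; rewrite /g /= eqxx.
- have r_le : x - q * l.-1 <= q by rewrite leq_subLR -lE.
  exists (inord (x - q * l.-1)) => //; apply/val_inj.
  have rE : (inord (x - q * l.-1) : 'I_q.+2) = x - q * l.-1 :> nat by rewrite inordK // ltnS leqW.
  by rewrite /= g_val rE ?subnKC // ltn_eqF.
- case: (eqVneq (r : nat) q.+1) => [rE|r_neq]; [left|right].
    by rewrite /g rE eqxx.
  by rewrite g_val // leq_addr g_lt.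
Qed.

Lemma card_face_base l : #|porbit phi (face_base l)| = if l == 0 :> nat then M.+2 else q.+2.
Proof.
rewrite -(card_in_imset (@face_base_tail_inj l)) face_base_tails.
case: (posnP l) => [l0|l_gt0]; last by rewrite card_on_face // l_gt0 leq_ord.
by rewrite (eq_card (B := predT)) ?card_ord // => x; rewrite !inE /on_face l0.
Qed.

Lemma fan_euler : (#|'I_M.+2| + #|face_sets fan_rot|).*2 = #|{: dartF}| + 4.
Proof.
rewrite card_fan_face_sets card_ord -(sum_card_porbits phi) -/(face_sets fan_rot) fan_face_sets.
rewrite big_imset /=; last by move=> ? ? _ _; apply: face_base_inj.
rewrite big_ord_recl card_face_base /= (eq_bigr (fun=> q.+2)); last first.
  by move=> l _; rewrite card_face_base.
rewrite sum_nat_const card_ord /M; move: q f; clear => q f; nia.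
Qed.

Definition fan_minus (w : 'I_M.+2) : rel 'I_M.+2 :=
  [rel x y | [&& fan_adj x y, x != w & y != w]].

(** Without the hub the path remains. Otherwise a vertex before [w] descends to 0 and one after [w]
    climbs to [M], and both ends are adjacent to the hub. *)
Lemma fan_minus_connect w u v : u != w -> v != w -> connect (fan_minus w) u v.
Proof.
have sym : connect_sym (fan_minus w).
  by apply: sym_connect_sym => x y; congr (_ && _); [apply: fan_adj_sym|apply: andbC].
suff [b base] : exists b, forall x, x != w -> connect (fan_minus w) x b.
  by move=> uw vw; apply: connect_trans (base u uw) _; rewrite sym base.
have M2 n : n <= M -> n < M.+2 by move=> nM; rewrite ltnS leqW.
have down n (x y : 'I_M.+2) : n <= x -> x <= M -> y = n :> nat -> (forall z : 'I_M.+2, n <= z <= x -> z != w) ->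
    connect (fan_minus w) x y.
  move: {2}(x : nat) (erefl (x : nat)) => m; elim: m x => [|m IHm] x xE nx xM yE nw.
    have -> : y = x by apply/val_inj; rewrite /= yE xE; apply/eqP; rewrite -leqn0 -xE.
    exact: connect0.
  move: nx; rewrite leq_eqVlt => /predU1P[nE|nx].
    by have -> : y = x by apply/val_inj; rewrite /= yE.
  have m_lt : m < M.+2 by apply: M2; rewrite ltnW // -xE.
  apply: (connect_trans (y := Ordinal m_lt)).
    apply: connect1; apply/and3P; split; last 2 first.
    - by apply: nw; rewrite (ltnW nx) leqnn.
    - by apply: nw; rewrite /= -ltnS -xE nx xE leqnSn.
    by rewrite /fan_adj /fan_edge /= -xE eqxx xM orbT.
  apply: IHm => //=; first by rewrite -ltnS -xE.
    by rewrite ltnW // -xE.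
  by move=> z /andP[nz zm]; apply: nw; rewrite nz xE leqW.
have nat_neq (x y : 'I_M.+2) : x != y :> nat -> x != y by [].
case: (eqVneq w hub_ord) => [wE|w_hub].
  exists ord0 => x xw; apply: (down 0) => //.
    by rewrite -ltnS ltn_neqAle ord_hub andbT; apply: contra xw => /eqP xE; rewrite wE; apply/eqP/val_inj.
  move=> z /andP[_ zx]; apply: nat_neq; rewrite wE /= ltn_eqF //.
  apply: leq_ltn_trans zx _; rewrite ltn_neqAle ord_hub andbT.
  by apply: contra xw => /eqP xE; rewrite wE; apply/eqP/val_inj.
have wM : w <= M.
  by rewrite -ltnS ltn_neqAle ord_hub andbT; apply: contra w_hub => /eqP xE; apply/eqP/val_inj.
have to_hub (x : 'I_M.+2) : x != w -> x <= M -> q %| x -> connect (fan_minus w) x hub_ord.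
  move=> xw xM qx; apply: connect1; apply/and3P; split=> //; last by rewrite eq_sym.
  by rewrite /fan_adj /fan_edge /= eqxx xM qx !orbT.
exists hub_ord => x xw; have [->|x_hub] := eqVneq x hub_ord; first exact: connect0.
have xM : x <= M.
  by rewrite -ltnS ltn_neqAle ord_hub andbT; apply: contra x_hub => /eqP xE; apply/eqP/val_inj.
have [xw_lt|wx_lt|eq_xw] := ltngtP x w; last by rewrite (val_inj eq_xw) eqxx in xw.
  have lt_neq (z : 'I_M.+2) : z <= x -> z != w.
    by move=> zx; apply: nat_neq; rewrite ltn_eqF // (leq_ltn_trans zx).
  apply: connect_trans (to_hub ord0 _ _ _); rewrite ?dvdn0 ?lt_neq //.
  by apply: (down 0) => // z /andP[_]; apply: lt_neq.
pose xM' : 'I_M.+2 := Ordinal (M2 M (leqnn M)).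
have gt_neq (z : 'I_M.+2) : x <= z -> z != w.
  by move=> xz; apply: nat_neq; rewrite gtn_eqF // (leq_trans wx_lt).
apply: connect_trans (to_hub xM' _ _ _); rewrite ?gt_neq ?dvdn_mulr //.
by rewrite sym; apply: (down x) => // z /andP[xz _]; apply: gt_neq.
Qed.

Lemma fan_connected : connected_graph fan_graph.
Proof.
move=> u v; have [w] : exists w, w \notin [set u; v].
  apply/existsP; rewrite -negb_forall; apply/negP => /forallP all_uv.
  have : #|'I_M.+2| <= #|[set u; v]|.
    by apply/subset_leq_card/subsetP => w _; apply: all_uv.
  rewrite card_ord cards2 leqNgt; case/negP; apply: (@leq_trans 3); last by rewrite !ltnS.
  by case: (_ == _).
rewrite !inE negb_or => /andP[wu wv].
apply: (connect_sub (e := fan_minus w)); last by apply: fan_minus_connect; rewrite eq_sym.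
by move=> x y /= /and3P[xy _ _]; apply: connect1.
Qed.

Lemma fan_outerP : porbit phi (face_base ord0) \in face_sets fan_rot.
Proof. exact: imset_f. Qed.

Definition fan_plane_graph : plane_graph 'I_M.+2 :=
  PlaneGraph fan_rotP fan_connected fan_euler fan_outerP.

Lemma fan_interior F : F \in interior_faces fan_plane_graph ->
  exists2 l : 'I_f.+1, F = porbit phi (face_base l) & 0 < l.
Proof.
rewrite in_setD1 [face_sets _]fan_face_sets => /andP[F0 /imsetP[l _ FE]]; exists l => //.
by rewrite lt0n; apply: contra F0 => l0; rewrite FE; apply/eqP; congr (porbit _ (face_base _)); apply/val_inj/eqP.
Qed.

Lemma fan_plane_graphP : fan_kangulation fan_plane_graph q.+2 f.
Proof.
have bounded l : bounded_by_cycle (G := fan_plane_graph) (porbit phi (face_base l)).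
  split; last exact: face_base_tail_inj.
  by rewrite card_face_base; case: ifP => _; rewrite !ltnS.
split.
- split; first split.
  + by rewrite card_ord !ltnS.
  + exact: fan_connected.
  + exact: fan_minus_connect.
  + by apply: etrans (face_base_tails ord0) _; apply/setP => x; rewrite !inE.
  + exact: bounded.
  + move=> F /fan_interior[l -> l_gt0]; split; first exact: bounded.
    by rewrite card_face_base gtn_eqF.
- have := cardsD1 (pg_outer fan_plane_graph) (face_sets fan_rot).
  by rewrite fan_outerP card_fan_face_sets => -[].
- exists hub_ord => F /fan_interior[l -> _].
  by rewrite [face_verts _]face_base_tails inE /on_face eqxx orbT.
Qed.

End FanGraph.

(** * The extremal hypergraph *)

Lemma face_hypergraph_hub (V : finType) (G : plane_graph V) (f : nat) (E : 'I_f -> {set V}) v :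
  face_hypergraph G = [set E i | i : 'I_f] ->
  (forall i, v \in E i) <-> (forall F, F \in interior_faces G -> v \in face_verts F).
Proof.
move=> HE; split=> [v_all F F_int|v_all i].
  have : face_verts F \in face_hypergraph G by apply: imset_f.
  by rewrite HE => /imsetP[i _ ->].
have : E i \in face_hypergraph G by rewrite HE imset_f.
by case/imsetP=> F F_int ->; apply: v_all.
Qed.

Theorem theorem1p1 (R : realType) (k : nat) (hk : 3 <= k) :
  exists f1 : nat, forall f : nat, f1 <= f ->
    (exists (V : finType) (G : plane_graph V), fan_kangulation G k f) /\
    forall (V : finType) (G : plane_graph V), fan_kangulation G k f ->
      unique_maximizer R k ((k - 2) * f + 2) (face_hypergraph G).
Proof.
have k_gt0 : 0 < k by apply: leq_trans hk.
have [f1 hubless_le] := hubless_spectral_radius_le R hk.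
exists (f1 + 2) => f f_ge.
have f_ge1 : f1 <= f by apply: leq_trans f_ge; apply: leq_addr.
have f_ge2 : 2 <= f by apply: leq_trans f_ge; apply: leq_addl.
split.
  have q_gt0 : 0 < k - 2 by rewrite subn_gt0.
  have kE : (k - 2).+2 = k by rewrite -addn2 subnK // ltnW.
  exists 'I_((k - 2) * f).+2, (fan_plane_graph q_gt0 (ltnW f_ge2)).
  by rewrite -[X in fan_kangulation _ X]kE; apply: fan_plane_graphP.
move=> V G fanG; have [kangG fE [h hub]] := fanG.
have card_V := card_verts hk kangG; rewrite fE in card_V.
split; first by split=> //; exists G.
move=> W H' [card_W [G' kangG' ->]].
have fE' : #|interior_faces G'| = f.
  have := card_verts hk kangG'; rewrite card_W => /addIn/eqP.
  by rewrite eqn_pmul2l ?subn_gt0 // => /eqP ->.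
(* With a hub, [G'] is itself a fan and the two hypergraphs are isomorphic; without one, [c]
   separates the two radii strictly. *)
have [/existsP[h' /forall_inP hub']|no_hub] :=
    boolP [exists h', [forall F in interior_faces G', h' \in face_verts F]].
  have fanG' : fan_kangulation G' k f by split=> //; exists h'.
  have iso : hypergraph_iso (face_hypergraph G') (face_hypergraph G).
    apply: hypergraph_iso_trans (fan_hypergraph_iso hk fanG).
    exact/hypergraph_iso_sym/fan_hypergraph_iso.
  by split=> [|_]; [apply: spectral_radius_iso_le|].
suff lt_G : (spectral_radius R k (face_hypergraph G') < spectral_radius R k (face_hypergraph G))%R.
  by split=> [|eq_G]; [apply: ltW|rewrite eq_G ltxx in lt_G].
have [c c_ge0 cE] : exists2 c : R, (0 <= c)%R & (c ^+ k = 4 * f%:R - 6)%R.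
  apply: exists_root => //; have : (2 <= f%:R :> R)%R by rewrite ler_nat.
  lra.
apply: (@le_lt_trans _ _ c).
  have [E [a [b [po HE _]]]] := kangulation_face_order hk kangG'.
  rewrite HE; apply: (hubless_le _ _ _ _ _ _ po _ c c_ge0); rewrite ?fE' // => v.
  rewrite ltn_neqAle; apply/andP; split; last first.
    by rewrite -[leqRHS]card_ord max_card.
  apply: contra no_hub => /eqP v_deg; apply/existsP; exists v; apply/forall_inP.
  apply/(face_hypergraph_hub v HE) => i.
  have /eqP/setP/(_ i) : [set i | v \in E i] == setT.
    by rewrite eqEcard subsetT cardsT card_ord -[leqRHS]/(face_deg E v) v_deg leqnn.
  by rewrite !inE.
have [E [a [b [po HE covered]]]] := kangulation_face_order hk kangG.
rewrite HE; apply: (hub_spectral_radius_gt hk _ po covered _ _ c_ge0); rewrite ?fE //.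
exact/(face_hypergraph_hub h HE).
Qed.
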